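(* Let $\mathcal G=(V,E)$ be a constraint graph over $(\mathbb F,S)$ with $V$ countable, and $X=X_{\mathcal G}\subset V^{\mathbb F}$ its graph subshift. Suppose there are a finite set $A\subset V$ and a shift-invariant Borel probability measure $\mu$ on $X$ such that for $\mu$-almost every $x\in X$, every $S$-connected component of the set $x^{-1}(V\setminus A)\subset\mathbb F$ is finite. Then there exists a periodic treequence in $X$. Moreover, if $\mu(\{x\in X: x(\mathrm{id})=a_1\})>0$ for some $a_1\in A$, then there exists a periodic treequence $x\in X$ with $x(\mathrm{id})=a_1$.
   Context: $\mathbb F$ is a finitely generated free group with symmetric free generating set $S=B\cup B^{-1}$, $B$ a free basis. A constraint graph is $\mathcal G=(V,E)$ with $E\subset V\times V\times S$. $X_{\mathcal G}$ is the set of $x:\mathbb F\to V$ with $(x(f),x(fs);s)\in E$ for all $f\in\mathbb F$, $s\in S$, with the product topology; shifts $(\sigma_gx)(f)=x(g^{-1}f)$; $x$ is periodic if its stabilizer $\{f:\sigma_fx=x\}$ has finite index. The Cayley graph of $\mathbb F$ has vertex set $\mathbb F$ and an edge from $f$ to $fs$ for each $f\in\mathbb F$, $s\in S$. A subset $D\subset\mathbb F$ is $S$-connected if its induced subgraph in the Cayley graph is connected; an $S$-connected component of $F_0\subset\mathbb F$ is a maximal $S$-connected subset of $F_0$. *)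

(* Defs.v *)
From Stdlib Require Import Reals List Bool Arith Lia.
Import ListNotations.
Set Implicit Arguments.

(** * The free group of finite rank r, as reduced words.
    A letter (i, b) stands for the basis element b_i (b = true) or its
    inverse b_i^{-1} (b = false).  The free basis is B = {b_0,...,b_{r-1}}
    and S = B ∪ B^{-1} = the letters with index < r. *)
Definition letter := (nat * bool)%type.
Definition linv (a : letter) : letter := (fst a, negb (snd a)).
Definition letter_eqb (a b : letter) : bool :=
  Nat.eqb (fst a) (fst b) && Bool.eqb (snd a) (snd b).

Fixpoint reducedb (w : list letter) : bool :=
  match w with
  | a :: ((b :: _) as w') => negb (letter_eqb b (linv a)) && reducedb w'
  | _ => true
  end.

Definition in_rank (r : nat) (a : letter) : bool := Nat.ltb (fst a) r.

Definition validb (r : nat) (w : list letter) : bool :=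
  reducedb w && forallb (in_rank r) w.

Definition FG (r : nat) : Type := {w : list letter | validb r w = true}.

Definition push (a : letter) (l : list letter) : list letter :=
  match l with
  | b :: l' => if letter_eqb b (linv a) then l' else a :: l
  | [] => [a]
  end.
Definition normalize (w : list letter) : list letter := fold_right push [] w.

Lemma reducedb_tail a l : reducedb (a :: l) = true -> reducedb l = true.
Proof. destruct l; simpl; auto. intro H. apply andb_prop in H. tauto. Qed.

Lemma push_valid r a l :
  in_rank r a = true -> validb r l = true -> validb r (push a l) = true.
Proof.
  unfold validb; intros Ha Hl. apply andb_prop in Hl as [H1 H2].
  destruct l as [|b l'].
  - simpl. rewrite Ha. reflexivity.
  - destruct (letter_eqb b (linv a)) eqn:E.
    + simpl. rewrite E. simpl in H2. apply andb_prop in H2 as [_ H2].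
      rewrite (reducedb_tail _ _ H1), H2. reflexivity.
    + unfold push. rewrite E.
      change (reducedb (a :: b :: l') && forallb (in_rank r) (a :: b :: l') = true).
      change (negb (letter_eqb b (linv a)) && reducedb (b :: l') &&
              (in_rank r a && forallb (in_rank r) (b :: l')) = true).
      rewrite E, H1, Ha, H2. reflexivity.
Qed.

Lemma normalize_valid r w :
  forallb (in_rank r) w = true -> validb r (normalize w) = true.
Proof.
  induction w as [|a w IH]; simpl; intro H.
  - reflexivity.
  - apply andb_prop in H as [Ha Hw]. apply push_valid; auto.
Qed.

Lemma filter_in_rank r w : forallb (in_rank r) (filter (in_rank r) w) = true.
Proof.
  induction w as [|a w IH]; simpl; auto.
  destruct (in_rank r a) eqn:E; simpl; rewrite ?E; auto.
Qed.

(* the reduced form of a word (letters outside S are discarded, which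
   never happens for the words used below) *)
Definition nf (r : nat) (w : list letter) : FG r :=
  exist _ (normalize (filter (in_rank r) w))
        (normalize_valid r _ (filter_in_rank r w)).

Definition fg_id (r : nat) : FG r := nf r [].
Definition fg_mul (r : nat) (f g : FG r) : FG r := nf r (proj1_sig f ++ proj1_sig g).
Definition fg_inv (r : nat) (f : FG r) : FG r := nf r (map linv (rev (proj1_sig f))).
(* the generator s ∈ S as a group element (s must satisfy in_rank r s) *)
Definition fg_gen (r : nat) (s : letter) : FG r := nf r [s].

(** * Constraint graphs and graph subshifts.
    A constraint graph is G = (V, E) with E ⊂ V × V × S, encoded as a
    relation E : V -> V -> letter -> Prop (only letters in S matter). *)
Definition config (r : nat) (V : Type) : Type := FG r -> V.

Definition in_X (r : nat) (V : Type) (E : V -> V -> letter -> Prop)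
  (x : config r V) : Prop :=
  forall (f : FG r) (s : letter), in_rank r s = true ->
    E (x f) (x (fg_mul f (fg_gen r s))) s.

Definition shift (r : nat) (V : Type) (g : FG r) (x : config r V) : config r V :=
  fun f => x (fg_mul (fg_inv g) f).

(* x is periodic: its stabilizer has finite index, i.e. finitely many
   right cosets H t cover F_r *)
Definition stabilizes (r : nat) (V : Type) (x : config r V) (f : FG r) : Prop :=
  forall u, shift f x u = x u.

Definition periodic (r : nat) (V : Type) (x : config r V) : Prop :=
  exists reps : list (FG r),
    forall g : FG r, exists t, In t reps /\ stabilizes x (fg_mul g (fg_inv t)).

Inductive reach (r : nat) (C : FG r -> Prop) (f : FG r) : FG r -> Prop :=
| reach_refl : C f -> reach C f f
| reach_step : forall h s, reach C f h -> in_rank r s = true ->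
    C (fg_mul h (fg_gen r s)) -> reach C f (fg_mul h (fg_gen r s)).

Definition S_connected (r : nat) (C : FG r -> Prop) : Prop :=
  forall f g, C f -> C g -> reach C f g.

Definition subset_of (r : nat) (C D : FG r -> Prop) : Prop :=
  forall f, C f -> D f.

Definition S_component (r : nat) (D C : FG r -> Prop) : Prop :=
  (exists f, C f) /\ subset_of C D /\ S_connected C /\
  forall C', subset_of C C' -> subset_of C' D -> S_connected C' ->
             subset_of C' C.

Definition finite_set (r : nat) (C : FG r -> Prop) : Prop :=
  exists l : list (FG r), forall f, C f -> In f l.

(** * Borel probability measures on V^F (V countable, discrete).
    Since F_r is countable and V is countable discrete, the Borel
    σ-algebra of V^F is the σ-algebra generated by the coordinate
    cylinders {x | x f = v}. *)
Local Open Scope R_scope.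
Inductive borel (r : nat) (V : Type) : (config r V -> Prop) -> Prop :=
| borel_cyl : forall f v, borel (fun x => x f = v)
| borel_compl : forall A, borel A -> borel (fun x => ~ A x)
| borel_union : forall A : nat -> config r V -> Prop,
    (forall n, borel (A n)) -> borel (fun x => exists n, A n x).

Definition prob_measure (r : nat) (V : Type) (mu : (config r V -> Prop) -> R)
  : Prop :=
  (forall A, borel A -> 0 <= mu A) /\
  mu (fun _ => True) = 1 /\
  (forall A : nat -> config r V -> Prop,
     (forall n, borel (A n)) ->
     (forall n m x, n <> m -> A n x -> A m x -> False) ->
     infinite_sum (fun n => mu (A n)) (mu (fun x => exists n, A n x))).

Definition shift_invariant (r : nat) (V : Type) (mu : (config r V -> Prop) -> R)
  : Prop :=
  forall (g : FG r) A, borel A -> mu (fun x => A (shift g x)) = mu A.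

Definition ae_on (r : nat) (V : Type) (mu : (config r V -> Prop) -> R)
  (X P : config r V -> Prop) : Prop :=
  exists N, borel N /\ mu N = 0 /\ forall x, X x -> ~ N x -> P x.

Definition countable (V : Type) : Prop :=
  exists enc : V -> nat, forall u v, enc u = enc v -> u = v.

(* Main.v *)
(** Cut F, labelled by x, into cells: the points with a label in A, and the
    components of the complement, which are almost surely finite.  For each
    generator, classify the edges meeting A by their endpoints in A.  There are
    finitely many classes, and a finite multiset of cells can be glued to a
    finite F-set labelled along E as soon as, for every generator and class, as
    many edges leave the cells as enter them; F acts because it is free, and
    orbits of the F-set are periodic configurations.  Such a multiset is an
    integer relation with nonnegative coefficients among the vectors (outgoing
    minus incoming edges of each class), one for each of countably many cell
    types.  By Fourier-Motzkin elimination it exists, through any prescribed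
    cell, unless some linear functional is nonnegative and not identically zero
    on the vectors of the cells occurring with positive probability.  Shift
    invariance excludes this: the mean of the functional at the identity is 0,
    and by mass transport it is also a mean over whole cells. *)

From Stdlib Require Import Reals List Bool Arith Lia Lra ZArith Permutation
  ClassicalEpsilon FunctionalExtensionality PropExtensionality Cantor.
From Stdlib Require FinFun.
From Coquelicot Require Import Coquelicot.
Require Import Defs.
Import ListNotations.
Set Implicit Arguments.
Open Scope R_scope.

(** * The free group *)

Lemma letter_eqb_eq (a b : letter) : letter_eqb a b = true <-> a = b.
Proof.
  destruct a as [i p], b as [j q]; unfold letter_eqb; simpl.
  rewrite andb_true_iff, Nat.eqb_eq, eqb_true_iff.
  split; [intros [-> ->]; auto | intros H; injection H; auto].
Qed.

Lemma linv_linv (a : letter) : linv (linv a) = a.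
Proof. destruct a; unfold linv; simpl; rewrite negb_involutive; auto. Qed.

Lemma in_rank_linv (r : nat) (a : letter) : in_rank r (linv a) = in_rank r a.
Proof. reflexivity. Qed.

Lemma push_reduced (a : letter) (l : list letter) :
  reducedb l = true -> reducedb (push a l) = true.
Proof.
  destruct l as [|b l]; auto; intros H; unfold push.
  destruct (letter_eqb b (linv a)) eqn:E.
  - exact (reducedb_tail _ _ H).
  - change (negb (letter_eqb b (linv a)) && reducedb (b :: l) = true).
    rewrite E, H; auto.
Qed.

Lemma fold_push_reduced (l w : list letter) :
  reducedb l = true -> reducedb (fold_right push l w) = true.
Proof. intros H; induction w; simpl; auto using push_reduced. Qed.

Lemma normalize_reduced (w : list letter) : reducedb (normalize w) = true.
Proof. now apply fold_push_reduced. Qed.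

Lemma normalize_id (w : list letter) : reducedb w = true -> normalize w = w.
Proof.
  induction w as [|a w IH]; auto; intros H.
  change (push a (normalize w) = a :: w).
  rewrite (IH (reducedb_tail _ _ H)).
  destruct w as [|b w]; auto.
  change (negb (letter_eqb b (linv a)) && reducedb (b :: w) = true) in H.
  apply andb_true_iff in H as [H _]; apply negb_true_iff in H.
  unfold push; now rewrite H.
Qed.

(** Van der Waerden's argument: letters act on the reduced words by [push], and inverse letters act
    as inverse maps. Associativity and the inverse law below are read off from this action instead
    of from an analysis of cancellations. *)
Lemma push_linv_push (a : letter) (l : list letter) :
  reducedb l = true -> push a (push (linv a) l) = l.
Proof.
  destruct l as [|b l]; intros H; unfold push at 2.
  - simpl. rewrite (proj2 (letter_eqb_eq _ _) eq_refl); auto.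
  - rewrite linv_linv.
    destruct (letter_eqb b a) eqn:E.
    + apply letter_eqb_eq in E; subst b.
      destruct l as [|c l]; auto.
      change (negb (letter_eqb c (linv a)) && reducedb (c :: l) = true) in H.
      apply andb_true_iff in H as [H _]; apply negb_true_iff in H.
      unfold push; now rewrite H.
    + unfold push; now rewrite (proj2 (letter_eqb_eq _ _) eq_refl).
Qed.

Lemma fold_push_push (l w : list letter) (a : letter) : reducedb l = true ->
  fold_right push l (push a w) = push a (fold_right push l w).
Proof.
  intros H; destruct w as [|b w]; auto; unfold push at 2.
  destruct (letter_eqb b (linv a)) eqn:E; auto.
  apply letter_eqb_eq in E; subst b; simpl.
  now rewrite push_linv_push by now apply fold_push_reduced.
Qed.

(** A word and its reduced form act alike, because each cancellation removes a pair of letters that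
    acts trivially. *)
Lemma fold_push_normalize (l w : list letter) : reducedb l = true ->
  fold_right push l (normalize w) = fold_right push l w.
Proof.
  intros H; induction w as [|a w IH]; auto; simpl.
  now rewrite fold_push_push, IH.
Qed.

Lemma fold_push_inverse (l w : list letter) : reducedb l = true ->
  fold_right push l (w ++ map linv (rev w)) = l.
Proof.
  revert l; induction w as [|a w IH]; intros l H; auto; simpl.
  rewrite map_app, app_assoc, fold_right_app; simpl.
  rewrite IH by now apply push_reduced.
  now apply push_linv_push.
Qed.

Lemma FG_eq (r : nat) (f g : FG r) : proj1_sig f = proj1_sig g -> f = g.
Proof.
  destruct f as [u p], g as [v q]; simpl; intros <-.
  f_equal; apply Eqdep_dec.UIP_dec, bool_dec.
Qed.

Lemma FG_reduced (r : nat) (f : FG r) : reducedb (proj1_sig f) = true.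
Proof. destruct f as [u p]; simpl; now apply andb_true_iff in p. Qed.

Lemma FG_in_rank (r : nat) (f : FG r) : forallb (in_rank r) (proj1_sig f) = true.
Proof. destruct f as [u p]; simpl; now apply andb_true_iff in p. Qed.

Lemma word_nf (r : nat) (w : list letter) :
  forallb (in_rank r) w = true -> proj1_sig (nf r w) = normalize w.
Proof.
  intros H; simpl; f_equal.
  induction w as [|a w IH]; auto; simpl in *.
  apply andb_true_iff in H as [Ha H]; rewrite Ha, IH; auto.
Qed.

Lemma word_mul (r : nat) (f g : FG r) :
  proj1_sig (fg_mul f g) = normalize (proj1_sig f ++ proj1_sig g).
Proof. apply word_nf; rewrite forallb_app, !FG_in_rank; auto. Qed.

Lemma word_inv (r : nat) (f : FG r) :
  proj1_sig (fg_inv f) = normalize (map linv (rev (proj1_sig f))).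
Proof.
  apply word_nf; pose proof (FG_in_rank f) as H.
  rewrite forallb_forall in *; intros a Ha.
  apply in_map_iff in Ha as [b [<- Hb]]; rewrite in_rank_linv.
  now apply H, in_rev.
Qed.

Lemma word_gen (r : nat) (s : letter) :
  in_rank r s = true -> proj1_sig (fg_gen r s) = [s].
Proof. intros H; unfold fg_gen; rewrite word_nf; simpl; auto; now rewrite H. Qed.

Lemma mul_assoc (r : nat) (f g h : FG r) :
  fg_mul (fg_mul f g) h = fg_mul f (fg_mul g h).
Proof.
  apply FG_eq; rewrite !word_mul; unfold normalize at 1 3.
  rewrite !fold_right_app; fold (normalize (proj1_sig h)).
  fold (normalize (normalize (proj1_sig g ++ proj1_sig h))).
  rewrite fold_push_normalize by apply normalize_reduced.
  rewrite (normalize_id (normalize _)) by apply normalize_reduced.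
  unfold normalize; now rewrite !fold_right_app.
Qed.

Lemma mul_1l (r : nat) (f : FG r) : fg_mul (fg_id r) f = f.
Proof. apply FG_eq; rewrite word_mul; simpl; apply normalize_id, FG_reduced. Qed.

Lemma mul_1r (r : nat) (f : FG r) : fg_mul f (fg_id r) = f.
Proof.
  apply FG_eq; rewrite word_mul; simpl; rewrite app_nil_r.
  apply normalize_id, FG_reduced.
Qed.

Lemma mul_invr (r : nat) (f : FG r) : fg_mul f (fg_inv f) = fg_id r.
Proof.
  apply FG_eq; rewrite word_mul, word_inv; unfold normalize at 1.
  rewrite fold_right_app; fold (normalize (normalize (map linv (rev (proj1_sig f))))).
  rewrite normalize_id by apply normalize_reduced.
  unfold normalize; rewrite <- fold_right_app; now apply fold_push_inverse.
Qed.

Lemma mul_invl (r : nat) (f : FG r) : fg_mul (fg_inv f) f = fg_id r.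
Proof.
  rewrite <- (mul_1r (fg_mul _ _)), <- (mul_invr (fg_inv f)), mul_assoc.
  now rewrite <- (mul_assoc f), mul_invr, mul_1l, mul_invr.
Qed.

Lemma mul_invl_assoc (r : nat) (f g : FG r) : fg_mul (fg_inv f) (fg_mul f g) = g.
Proof. now rewrite <- mul_assoc, mul_invl, mul_1l. Qed.

Lemma mul_invr_assoc (r : nat) (f g : FG r) : fg_mul f (fg_mul (fg_inv f) g) = g.
Proof. now rewrite <- mul_assoc, mul_invr, mul_1l. Qed.

Lemma mul_cancel_l (r : nat) (f g h : FG r) : fg_mul f g = fg_mul f h -> g = h.
Proof.
  intros H; now rewrite <- (mul_invl_assoc f g), H, mul_invl_assoc.
Qed.

Lemma inv_inv (r : nat) (f : FG r) : fg_inv (fg_inv f) = f.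
Proof. apply (@mul_cancel_l r (fg_inv f)); now rewrite mul_invr, mul_invl. Qed.

Lemma inv_mul (r : nat) (f g : FG r) :
  fg_inv (fg_mul f g) = fg_mul (fg_inv g) (fg_inv f).
Proof.
  apply (@mul_cancel_l r (fg_mul f g)).
  now rewrite mul_invr, mul_assoc, mul_invr_assoc, mul_invr.
Qed.

Lemma mul_gen_linv (r : nat) (f : FG r) (s : letter) : in_rank r s = true ->
  fg_mul (fg_mul f (fg_gen r s)) (fg_gen r (linv s)) = f.
Proof.
  intros H; rewrite mul_assoc.
  replace (fg_mul (fg_gen r s) (fg_gen r (linv s))) with (fg_id r);
    [apply mul_1r|].
  apply FG_eq; rewrite word_mul, !word_gen by auto; simpl.
  now rewrite (proj2 (letter_eqb_eq _ _) eq_refl).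
Qed.

Lemma mul_linv_gen (r : nat) (f : FG r) (s : letter) : in_rank r s = true ->
  fg_mul (fg_mul f (fg_gen r (linv s))) (fg_gen r s) = f.
Proof.
  intros H; rewrite <- (linv_linv s) at 2; now apply mul_gen_linv.
Qed.

(** * Actions of the free group *)

Section Action.
Context {Y : Type} (step : letter -> Y -> Y).
Hypothesis step_linv : forall a y, step (linv a) (step a y) = y.

Definition word_act (y : Y) (w : list letter) : Y :=
  fold_left (fun z a => step a z) w y.

Lemma word_act_push (y : Y) (a : letter) (l : list letter) :
  word_act y (push a l) = word_act (step a y) l.
Proof.
  destruct l as [|b l]; auto; unfold push.
  destruct (letter_eqb b (linv a)) eqn:E; auto.
  apply letter_eqb_eq in E; subst b; simpl; now rewrite step_linv.
Qed.

Lemma word_act_normalize (w : list letter) (y : Y) :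
  word_act y (normalize w) = word_act y w.
Proof.
  revert y; induction w as [|a w IH]; intros y; auto.
  change (word_act y (push a (normalize w)) = word_act (step a y) w).
  now rewrite word_act_push.
Qed.

(** Universal property of the free group: steps that are undone by the steps of the inverse letters
    extend to a right action, since cancelling letters leaves [word_act] unchanged. *)
Lemma word_act_mul (r : nat) (f g : FG r) (y : Y) :
  word_act y (proj1_sig (fg_mul f g)) =
  word_act (word_act y (proj1_sig f)) (proj1_sig g).
Proof. rewrite word_mul, word_act_normalize; apply fold_left_app. Qed.
End Action.

(** * Integer relations *)

Definition sumZ {T : Type} (f : T -> Z) (l : list T) : Z :=
  fold_right (fun t s => (f t + s)%Z) 0%Z l.
Definition sumR {T : Type} (f : T -> R) (l : list T) : R :=
  fold_right (fun t s => f t + s) 0 l.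

Lemma sumZ_app (T : Type) (f : T -> Z) (l l' : list T) :
  sumZ f (l ++ l') = (sumZ f l + sumZ f l')%Z.
Proof. induction l; simpl; lia. Qed.

Lemma sumZ_repeat (T : Type) (f : T -> Z) (t : T) (n : nat) :
  sumZ f (repeat t n) = (Z.of_nat n * f t)%Z.
Proof. induction n; simpl repeat; [auto|]; simpl sumZ; rewrite IHn; lia. Qed.

Lemma sumZ_flat_map (S T : Type) (f : T -> Z) (g : S -> list T) (l : list S) :
  sumZ f (flat_map g l) = sumZ (fun s => sumZ f (g s)) l.
Proof. induction l; simpl; auto; now rewrite sumZ_app, IHl. Qed.

Lemma sumZ_ext_in (T : Type) (f g : T -> Z) (l : list T) :
  (forall t, In t l -> f t = g t) -> sumZ f l = sumZ g l.
Proof. induction l; simpl; intros H; auto; rewrite H, IHl; auto. Qed.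

Lemma sumZ_map (S T : Type) (f : T -> Z) (g : S -> T) (l : list S) :
  sumZ f (map g l) = sumZ (fun s => f (g s)) l.
Proof. induction l; simpl; congruence. Qed.

Lemma sumR_app (T : Type) (f : T -> R) (l l' : list T) :
  sumR f (l ++ l') = sumR f l + sumR f l'.
Proof. induction l; simpl; lra. Qed.

Lemma sumR_ext_in (T : Type) (f g : T -> R) (l : list T) :
  (forall t, In t l -> f t = g t) -> sumR f l = sumR g l.
Proof. induction l; simpl; intros H; auto; rewrite H, IHl; auto. Qed.

Lemma sumR_map (S T : Type) (f : T -> R) (g : S -> T) (l : list S) :
  sumR f (map g l) = sumR (fun s => f (g s)) l.
Proof. induction l; simpl; congruence. Qed.

Lemma sumR_plus (T : Type) (f g : T -> R) (l : list T) :
  sumR (fun t => f t + g t) l = sumR f l + sumR g l.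
Proof. induction l; simpl; lra. Qed.

Lemma sumR_scal (T : Type) (a : R) (f : T -> R) (l : list T) :
  sumR (fun t => a * f t) l = a * sumR f l.
Proof. induction l; simpl; lra. Qed.

(** A linear functional as a formal list of coefficients and coordinates; a coordinate may recur,
    and adding a term is consing. *)
Definition lin {C : Type} (ps : list (R * C)) (v : C -> Z) : R :=
  sumR (fun p => fst p * IZR (v (snd p))) ps.

Lemma lin_comb (C : Type) (ps : list (R * C)) (a b : Z) (v w : C -> Z) :
  lin ps (fun c => (a * v c + b * w c)%Z) = IZR a * lin ps v + IZR b * lin ps w.
Proof.
  unfold lin; rewrite <- !sumR_scal, <- sumR_plus.
  apply sumR_ext_in; intros p _; rewrite plus_IZR, !mult_IZR; lra.
Qed.

(** The dual side of a Stiemke alternative: a closed half-space through 0 contains the family only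
    if its bounding hyperplane does. The index type [J] may be infinite. *)
Definition no_proper_functional {J C : Type} (cs : list C) (v : J -> C -> Z) :=
  forall ps : list (R * C), (forall p, In p ps -> In (snd p) cs) ->
    (forall j, 0 <= lin ps (v j)) -> forall j, lin ps (v j) = 0.

(** The condition on [a] is a lower bound [- (y j / x j)] where [x j] is positive and an upper bound
    of the same form where it is negative. The cross condition puts every lower bound below every
    upper bound, and the supremum of the lower bounds serves. *)
Lemma elimination_scalar {J : Type} (x y : J -> R) :
  (exists j, x j < 0) -> (exists j, x j > 0) ->
  (forall j, x j = 0 -> 0 <= y j) ->
  (forall j k, x j > 0 -> x k < 0 -> 0 <= - x k * y j + x j * y k) ->
  exists a, forall j, 0 <= a * x j + y j.
Proof.
  intros [k0 Hk0] [j0 Hj0] H0 H.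
  assert (Hcmp : forall j k, x j > 0 -> x k < 0 -> - (y j / x j) <= - (y k / x k)).
  { intros j k Hj Hk; specialize (H j k Hj Hk).
    assert (y k / x k <= y j / x j); [|lra].
    apply Rmult_le_reg_l with (x j * - x k); [nra|].
    replace (x j * - x k * (y k / x k)) with (- (x j * y k)) by (field; lra).
    replace (x j * - x k * (y j / x j)) with (- x k * y j) by (field; lra).
    lra. }
  destruct (completeness (fun a => exists j, x j > 0 /\ a = - (y j / x j)))
    as [a [Ha1 Ha2]].
  - exists (- (y k0 / x k0)); intros a [j [Hj ->]]; auto.
  - exists (- (y j0 / x j0)), j0; auto.
  - exists a; intros j.
    destruct (Rtotal_order (x j) 0) as [Hj|[Hj|Hj]].
    + assert (a <= - (y j / x j)).
      { apply Ha2; intros b [k [Hk ->]]; auto. }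
      replace (y j) with (y j / x j * x j) by (field; lra); nra.
    + rewrite Hj; specialize (H0 _ Hj); lra.
    + assert (- (y j / x j) <= a) by (apply Ha1; eauto).
      replace (y j) with (y j / x j * x j) by (field; lra); nra.
Qed.

(* Fourier-Motzkin elimination of the first coordinate: vectors with opposite
   signs there are paired off, and a functional on the resulting family extends
   to the original one by [elimination_scalar]. *)
Theorem integer_relation {C : Type} (cs : list C) (J : Type) (v : J -> C -> Z) :
  no_proper_functional cs v -> forall j0, exists l, In j0 l /\
    forall c, In c cs -> sumZ (fun j => v j c) l = 0%Z.
Proof.
  revert J v; induction cs as [|c cs IH]; intros J v H j0.
  { exists [j0]; simpl; tauto. }
  set (J' := ({j | v j c = 0%Z} +
              {j | (v j c > 0)%Z} * {k | (v k c < 0)%Z})%type).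
  (* A positive vector and a negative one cancel in coordinate [c] when each is repeated as often as
     the other's entry is large. Multiplicities are natural numbers, so that the final relation has
     nonnegative coefficients. *)
  set (expand := fun t : J' => match t with
       | inl j => [proj1_sig j]
       | inr (j, k) => repeat (proj1_sig j) (Z.to_nat (- v (proj1_sig k) c)) ++
                       repeat (proj1_sig k) (Z.to_nat (v (proj1_sig j) c))
       end).
  set (v' := fun t c' => sumZ (fun j => v j c') (expand t)).
  assert (Hc : forall t, v' t c = 0%Z).
  { intros [[j Hj]|[[j Hj] [k Hk]]]; unfold v'; simpl; [lia|].
    rewrite sumZ_app, !sumZ_repeat, !Z2Nat.id by lia; lia. }
  assert (Hlin : forall ps t, lin ps (v' t) = match t with
       | inl j => lin ps (v (proj1_sig j))
       | inr (j, k) => - IZR (v (proj1_sig k) c) * lin ps (v (proj1_sig j)) +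
                       IZR (v (proj1_sig j) c) * lin ps (v (proj1_sig k))
       end).
  { intros ps [[j Hj]|[[j Hj] [k Hk]]]; simpl.
    - apply sumR_ext_in; intros p _; unfold v'; simpl; now rewrite Z.add_0_r.
    - rewrite <- opp_IZR, <- lin_comb.
      apply sumR_ext_in; intros p _; unfold v'; simpl.
      now rewrite sumZ_app, !sumZ_repeat, !Z2Nat.id by lia. }
  assert (Hsingle : forall a j, lin [(a, c)] (v j) = a * IZR (v j c))
    by (intros; unfold lin; simpl; lra).
  (* The functional plus or minus coordinate [c]: if that coordinate has one sign on the whole
     family, it vanishes there. Hence positive and negative entries occur together. *)
  assert (Hno : forall b : bool,
    (forall j, if b then (v j c >= 0)%Z else (v j c <= 0)%Z) ->
                forall j, v j c = 0%Z).
  { intros b Hb j; apply eq_IZR.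
    cut (lin [(if b then 1 else -1, c)] (v j) = 0).
    { rewrite Hsingle; destruct b; lra. }
    apply H.
    - intros p [<-|[]]; simpl; auto.
    - intros k; rewrite Hsingle; specialize (Hb k).
      destruct b; [apply Z.ge_le in Hb|]; apply IZR_le in Hb; lra. }
  assert (Hpos : forall j, (v j c < 0)%Z -> exists k, (v k c > 0)%Z).
  { intros j Hj; apply NNPP; intros N; enough (v j c = 0%Z) by lia.
    apply (Hno false); intros k; destruct (Z_le_gt_dec (v k c) 0); auto.
    destruct N; eauto. }
  assert (Hneg : forall j, (v j c > 0)%Z -> exists k, (v k c < 0)%Z).
  { intros j Hj; apply NNPP; intros N; enough (v j c = 0%Z) by lia.
    apply (Hno true); intros k; destruct (Z_lt_ge_dec (v k c) 0); auto.
    destruct N; eauto. }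
  assert (H' : no_proper_functional cs v').
  { intros ps Hps Hps0.
    assert (Ha : exists a, forall j, 0 <= a * IZR (v j c) + lin ps (v j)).
    { destruct (classic (exists j, (v j c > 0)%Z)) as [[j Hj]|N].
      - destruct (Hneg j Hj) as [k Hk].
        apply elimination_scalar.
        + exists k; now apply IZR_lt.
        + exists j; apply IZR_lt; lia.
        + intros i Hi; apply eq_IZR in Hi.
          specialize (Hps0 (inl (exist _ i Hi))); now rewrite Hlin in Hps0.
        + intros i m Hi Hm; apply lt_IZR in Hi; apply lt_IZR in Hm.
          apply Z.lt_gt in Hi.
          specialize (Hps0 (inr (exist _ i Hi, exist _ m Hm))).
          now rewrite Hlin in Hps0.
      (* With no positive entry there is no negative one, so the coordinate is identically 0 and
         every vector survives unchanged in the new family. *)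
      - exists 0; intros j; rewrite Rmult_0_l, Rplus_0_l.
        assert (Hj : v j c = 0%Z).
        { destruct (Z.lt_trichotomy (v j c) 0) as [Hj|[Hj|Hj]]; auto.
          - destruct (Hpos j Hj); destruct N; eauto.
          - destruct N; exists j; lia. }
        specialize (Hps0 (inl (exist _ j Hj))); now rewrite Hlin in Hps0. }
    destruct Ha as [a Ha].
    assert (Hcons : forall j, lin ((a, c) :: ps) (v j) =
                              a * IZR (v j c) + lin ps (v j)) by reflexivity.
    assert (Hz : forall j, a * IZR (v j c) + lin ps (v j) = 0).
    { intros j; rewrite <- Hcons; apply H.
      - intros p [<-|Hp]; simpl; auto.
      - intros k; rewrite Hcons; auto. }
    (* On the original family [lin ps] is now [- a] times coordinate [c], and that coordinate is 0
       on every expanded vector. *)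
    intros [[j Hj]|[[j Hj] [k Hk]]]; rewrite Hlin; simpl.
    - specialize (Hz j); rewrite Hj in Hz; lra.
    - replace (lin ps (v j)) with (- a * IZR (v j c)) by (specialize (Hz j); lra).
      replace (lin ps (v k)) with (- a * IZR (v k c)) by (specialize (Hz k); lra).
      lra. }
  (* The prescribed index survives elimination: if its entry is nonzero, it is paired with a vector
     of opposite sign. *)
  assert (Hj0 : exists t, In j0 (expand t)).
  { destruct (Z.lt_trichotomy (v j0 c) 0) as [Hj|[Hj|Hj]].
    - destruct (Hpos j0 Hj) as [k Hk].
      exists (inr (exist _ k Hk, exist _ j0 Hj)); simpl.
      apply in_or_app; right.
      destruct (Z.to_nat (v k c)) eqn:E; [lia|left; auto].
    - exists (inl (exist _ j0 Hj)); simpl; auto.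
    - apply Z.lt_gt in Hj; destruct (Hneg j0 Hj) as [k Hk].
      exists (inr (exist _ j0 Hj, exist _ k Hk)); simpl.
      apply in_or_app; left.
      destruct (Z.to_nat (- v k c)) eqn:E; [lia|left; auto]. }
  destruct Hj0 as [t Ht].
  destruct (IH _ v' H' t) as [l [Htl Hl]].
  exists (flat_map expand l); split.
  - apply in_flat_map; eauto.
  - intros c' [<-|Hc']; rewrite sumZ_flat_map; [|exact (Hl c' Hc')].
    clear -Hc; induction l as [|t l IHl]; simpl; auto.
    fold (v' t c); now rewrite Hc, IHl.
Qed.

(** * Borel sets and measures *)

Lemma countable_inj (S T : Type) (f : S -> T) :
  (forall u v, f u = f v -> u = v) -> countable T -> countable S.
Proof. intros Hf [enc He]; exists (fun s => enc (f s)); auto. Qed.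

Lemma countable_nat : countable nat.
Proof. now exists (fun n => n). Qed.

Lemma countable_prod (S T : Type) : countable S -> countable T -> countable (S * T).
Proof.
  intros [e He] [e' He']; exists (fun p => to_nat (e (fst p), e' (snd p))).
  intros [s t] [s' t'] H; apply to_nat_inj in H; injection H; simpl; intros.
  f_equal; auto.
Qed.

Lemma countable_list (T : Type) : countable T -> countable (list T).
Proof.
  intros [e He].
  exists (fix code l := match l with
                        | [] => 0%nat
                        | t :: l' => S (to_nat (e t, code l'))
                        end).
  induction u as [|t u IH]; intros [|t' v]; try discriminate; auto.
  intros H; apply eq_add_S, to_nat_inj in H; injection H; intros.
  f_equal; auto.
Qed.

Lemma countable_Z : countable Z.
Proof.
  apply countable_inj with (f := fun z => (Z.to_nat z, Z.to_nat (- z))).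
  - intros u v H; injection H; lia.
  - now apply countable_prod; apply countable_nat.
Qed.

Lemma countable_FG (r : nat) : countable (FG r).
Proof.
  apply countable_inj with (f := fun g : FG r =>
    map (fun a : letter => (fst a, Nat.b2n (snd a))) (proj1_sig g)).
  - intros u v H; apply FG_eq; revert H.
    generalize (proj1_sig u) (proj1_sig v).
    induction l as [|[i a] l IH]; intros [|[j b] l']; try discriminate; auto.
    simpl; intros H; injection H; intros H1 H2 ->.
    rewrite (IH _ H1); destruct a, b; try discriminate; auto.
  - apply countable_list, countable_prod; apply countable_nat.
Qed.

Lemma countable_letter : countable letter.
Proof.
  apply countable_inj with (f := fun a : letter => (fst a, Nat.b2n (snd a))).
  - intros [i []] [j []] H; simpl in H; congruence.
  - apply countable_prod; apply countable_nat.
Qed.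

Section Borel.
Context {r : nat} {V : Type}.
Implicit Types P Q : config r V -> Prop.

Lemma pred_ext P Q : (forall x, P x <-> Q x) -> P = Q.
Proof. intros H; extensionality x; now apply propositional_extensionality. Qed.

Lemma borel_ext P Q : (forall x, P x <-> Q x) -> borel P -> borel Q.
Proof. intros H; now rewrite (pred_ext P Q H). Qed.

(** Every derivation of [borel] goes back to a cylinder, which names a label. The main proof takes
    its label from the null set of the almost sure hypothesis. *)
Lemma borel_inhabited P : borel P -> inhabited V.
Proof. induction 1; auto; apply (H0 0%nat). Qed.

Hypothesis HV : inhabited V.

Lemma borel_const (p : Prop) : borel (fun _ : config r V => p).
Proof.
  destruct HV as [v].
  assert (HT : borel (fun _ : config r V => True)).
  (* The whole space is the union of a cylinder and its complement. *)
  { eapply borel_ext; [|apply borel_union with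
      (A := fun n x => match n with O => x (fg_id r) = v | _ => x (fg_id r) <> v end)].
    - intros x; split; auto; intros _.
      destruct (classic (x (fg_id r) = v)); [exists 0%nat | exists 1%nat]; auto.
    - intros [|n]; [|apply borel_compl]; apply borel_cyl. }
  destruct (classic p) as [Hp|Hp].
  - eapply borel_ext, HT; tauto.
  - eapply borel_ext, borel_compl, HT; tauto.
Qed.

Lemma borel_ex (T : Type) (P : T -> config r V -> Prop) :
  countable T -> (forall t, borel (P t)) -> borel (fun x => exists t, P t x).
Proof.
  intros [e He] H.
  eapply borel_ext; [|apply borel_union with
    (A := fun n x => exists t, e t = n /\ P t x)].
  - intros x; split; [intros (n & t & _ & Ht) | intros [t Ht]]; eauto.
  - intros n; destruct (classic (exists t, e t = n)) as [[t <-]|N].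
    + eapply borel_ext, (H t); intros x; split; eauto.
      intros (s & Hs & Hx); apply He in Hs; now subst.
    + eapply borel_ext, (borel_const False); intros x; split; [tauto|].
      intros (t & Ht & _); eauto.
Qed.

Lemma borel_all (T : Type) (P : T -> config r V -> Prop) :
  countable T -> (forall t, borel (P t)) -> borel (fun x => forall t, P t x).
Proof.
  intros HT H.
  apply borel_ext with (fun x => ~ exists t, ~ P t x).
  - intros x; split; [|firstorder].
    intros N t; apply NNPP; eauto.
  - apply borel_compl, borel_ex; auto; intros t; now apply borel_compl.
Qed.

Lemma borel_and P Q : borel P -> borel Q -> borel (fun x => P x /\ Q x).
Proof.
  intros HP HQ; apply borel_ext with
    (fun x => forall n : nat, match n with O => P x | _ => Q x end).
  - intros x; split; [|intros [? ?] [|]; auto].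
    intros H; split; [apply (H 0%nat) | apply (H 1%nat)].
  - apply borel_all; [apply countable_nat|intros [|]; auto].
Qed.

Lemma borel_or P Q : borel P -> borel Q -> borel (fun x => P x \/ Q x).
Proof.
  intros HP HQ; apply borel_ext with (fun x => ~ (~ P x /\ ~ Q x)).
  - intros x; tauto.
  - apply borel_compl, borel_and; now apply borel_compl.
Qed.

Lemma borel_imp P Q : borel P -> borel Q -> borel (fun x => P x -> Q x).
Proof.
  intros HP HQ; apply borel_ext with (fun x => ~ P x \/ Q x).
  - intros x; tauto.
  - apply borel_or; auto; now apply borel_compl.
Qed.

Lemma borel_iff P Q : borel P -> borel Q -> borel (fun x => P x <-> Q x).
Proof. intros; apply borel_and; now apply borel_imp. Qed.

Hypothesis HC : countable V.

(** As [V] is countable, the event is a countable union over the pairs of labels at [f] and [g]. *)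
Lemma borel_coord2 (P : V -> V -> Prop) (f g : FG r) :
  borel (fun x => P (x f) (x g)).
Proof.
  apply borel_ext with
    (fun x => exists p : V * V, (x f = fst p /\ x g = snd p) /\ P (fst p) (snd p)).
  - intros x; split.
    + intros ([u w] & [Hu Hw] & H); simpl in *; now subst.
    + intros H; exists (x f, x g); auto.
  - apply borel_ex; [now apply countable_prod|].
    intros p; apply borel_and; [|apply borel_const].
    apply borel_and; apply borel_cyl.
Qed.

Lemma borel_coord (P : V -> Prop) (f : FG r) : borel (fun x => P (x f)).
Proof. apply (borel_coord2 (fun u _ => P u) f f). Qed.

Lemma borel_in_X (E : V -> V -> letter -> Prop) : borel (in_X (r := r) E).
Proof.
  apply borel_all; [apply countable_FG|intros f].
  apply borel_all; [apply countable_letter|intros s].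
  apply borel_imp; [apply borel_const|].
  apply (borel_coord2 (fun u w => E u w s)).
Qed.

Definition borelZ (F : config r V -> Z) := forall z, borel (fun x => F x = z).

Lemma borelZ_const (z : Z) : borelZ (fun _ => z).
Proof. intros z'; apply borel_const. Qed.

Lemma borelZ_plus (F G : config r V -> Z) :
  borelZ F -> borelZ G -> borelZ (fun x => F x + G x)%Z.
Proof.
  intros HF HG z; apply borel_ext with (fun x => exists a, F x = a /\ G x = (z - a)%Z).
  - intros x; split; [intros [a [? ?]]; lia|].
    intros H; exists (F x); lia.
  - apply borel_ex; [apply countable_Z|]; intros a; apply borel_and; auto.
Qed.

Lemma borelZ_opp (F : config r V -> Z) : borelZ F -> borelZ (fun x => - F x)%Z.
Proof.
  intros HF z; eapply borel_ext, (HF (- z)%Z); intros x; cbv beta; lia.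
Qed.

Lemma borelZ_sum (T : Type) (F : T -> config r V -> Z) (l : list T) :
  (forall t, borelZ (F t)) -> borelZ (fun x => sumZ (fun t => F t x) l).
Proof.
  intros H; induction l; simpl; [apply borelZ_const | now apply borelZ_plus].
Qed.

Definition indZ (p : Prop) : Z := if excluded_middle_informative p then 1%Z else 0%Z.

Lemma borelZ_ind P : borel P -> borelZ (fun x => indZ (P x)).
Proof.
  intros HP z; apply borel_ext with (fun x => (P x /\ z = 1%Z) \/ (~ P x /\ z = 0%Z)).
  - intros x; unfold indZ; destruct (excluded_middle_informative (P x)); intuition.
  - apply borel_or; apply borel_and; auto using borel_compl, borel_const.
Qed.
End Borel.

Lemma indZ_true (p : Prop) : p -> indZ p = 1%Z.
Proof. unfold indZ; destruct (excluded_middle_informative p); tauto. Qed.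

Lemma indZ_false (p : Prop) : ~ p -> indZ p = 0%Z.
Proof. unfold indZ; destruct (excluded_middle_informative p); tauto. Qed.

Lemma indZ_iff (p q : Prop) : (p <-> q) -> indZ p = indZ q.
Proof. intros H; now rewrite (propositional_extensionality _ _ H). Qed.

(** * Probability measures and simple functions *)

Section Measure.
Context {r : nat} {V : Type} (mu : (config r V -> Prop) -> R).
Implicit Types P Q : config r V -> Prop.
Hypothesis HV : inhabited V.
Hypothesis Hmu : prob_measure mu.

Lemma mu_ext P Q : (forall x, P x <-> Q x) -> mu P = mu Q.
Proof. intros H; now rewrite (pred_ext P Q H). Qed.

Lemma mu_ge0 P : borel P -> 0 <= mu P.
Proof. apply Hmu. Qed.

Lemma mu_series (P : nat -> config r V -> Prop) : (forall n, borel (P n)) ->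
  (forall n m x, n <> m -> P n x -> P m x -> False) ->
  is_series (fun n => mu (P n)) (mu (fun x => exists n, P n x)).
Proof. intros; apply is_series_Reals, Hmu; auto. Qed.

(** Copies of the empty set are disjoint, so their constant measures form a convergent series, whose
    terms tend to 0. *)
Lemma mu_empty P : (forall x, ~ P x) -> mu P = 0.
Proof.
  intros H.
  assert (HP : borel P).
  { eapply borel_ext, (borel_const HV False); firstorder. }
  assert (Hs : is_series (fun _ : nat => mu P) (mu (fun x => exists n : nat, P x))).
  { apply mu_series with (P := fun _ => P); auto; firstorder. }
  assert (Hl : is_lim_seq (fun _ : nat => mu P) 0).
  { apply ex_series_lim_0; eexists; exact Hs. }
  apply is_lim_seq_unique in Hl; rewrite Lim_seq_const in Hl; congruence.
Qed.

Lemma mu_disjoint P Q : borel P -> borel Q -> (forall x, P x -> Q x -> False) ->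
  mu (fun x => P x \/ Q x) = mu P + mu Q.
Proof.
  intros HP HQ HD.
  set (A := fun n : nat => match n with 0 => P | 1 => Q | _ => fun _ => False end%nat).
  rewrite (@mu_ext _ (fun x => exists n, A n x)).
  - eapply uniqueness_sum.
    + apply Hmu; [intros [|[|n]]; simpl; auto; now apply borel_const|].
      intros [|[|n]] [|[|m]] x; simpl; firstorder.
    + intros eps Heps; exists 1%nat; intros n Hn.
      replace (sum_f_R0 (fun n => mu (A n)) n) with (mu P + mu Q).
      * now rewrite Rdist_eq.
      * induction Hn; simpl in *; auto.
        rewrite <- IHHn; destruct m; [lia|].
        rewrite (@mu_empty (fun _ => False)); [lra|auto].
  - intros x; split.
    + intros [H|H]; [exists 0%nat | exists 1%nat]; auto.
    + intros [[|[|n]] H]; simpl in H; tauto.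
Qed.

Lemma mu_split P Q : borel P -> borel Q ->
  mu P = mu (fun x => P x /\ Q x) + mu (fun x => P x /\ ~ Q x).
Proof.
  intros HP HQ; rewrite <- mu_disjoint.
  - apply mu_ext; intros x; tauto.
  - now apply borel_and.
  - apply borel_and; auto; now apply borel_compl.
  - tauto.
Qed.

Lemma mu_mono P Q : borel P -> borel Q -> (forall x, P x -> Q x) -> mu P <= mu Q.
Proof.
  intros HP HQ H; rewrite (mu_split HQ HP).
  rewrite (@mu_ext (fun x => Q x /\ P x) P) by firstorder.
  pose proof (mu_ge0 (borel_and HV HQ (borel_compl HP))); lra.
Qed.

Lemma mu_null_sub P Q : borel P -> borel Q -> (forall x, P x -> Q x) ->
  mu Q = 0 -> mu P = 0.
Proof.
  intros HP HQ H H0; pose proof (mu_mono HP HQ H); pose proof (mu_ge0 HP); lra.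
Qed.

Lemma mu_null_ex (T : Type) (P : T -> config r V -> Prop) : countable T ->
  (forall t, borel (P t)) -> (forall t, mu (P t) = 0) ->
  mu (fun x => exists t, P t x) = 0.
Proof.
  intros [e He] HP H0.
  set (Q := fun n x => exists t, e t = n /\ P t x).
  assert (HQ : forall n, borel (Q n)).
  { intros n; apply (borel_ex HV); [now exists e|].
    intros t; apply (borel_and HV); auto; now apply borel_const. }
  assert (HQ0 : forall n, mu (Q n) = 0).
  { intros n; destruct (classic (exists t, e t = n)) as [[t Ht]|N].
    - apply mu_null_sub with (P t); auto.
      intros x (s & Hs & Hx); rewrite <- Ht in Hs; apply He in Hs; now subst.
    - apply mu_empty; intros x (t & Ht & _); eauto. }
  (* Keeping only the least index makes the union disjoint. *)
  set (D := fun n x => Q n x /\ forall m, (m < n)%nat -> ~ Q m x).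
  assert (HD : forall n, borel (D n)).
  { intros n; apply (borel_and HV); auto; apply (borel_all HV); [apply countable_nat|].
    intros m; apply (borel_imp HV); [now apply borel_const|now apply borel_compl]. }
  rewrite (@mu_ext _ (fun x => exists n, D n x)).
  - eapply uniqueness_sum; [apply Hmu; auto|].
    + intros n m x Hnm [H1 H2] [H3 H4].
      destruct (Nat.lt_gt_cases n m) as [[Hl|Hl] _]; auto; [eapply H4|eapply H2]; eauto.
    + intros eps Heps; exists 0%nat; intros n _.
      rewrite (sum_eq_R0 (fun n => mu (D n))); [now rewrite Rdist_eq|].
      intros m _; apply mu_null_sub with (Q m); auto; now intros x [? _].
  - intros x; split.
    + intros [t Ht].
      assert (Hx : exists n, Q n x) by (exists (e t), t; auto).
      destruct (Wf_nat.dec_inh_nat_subset_has_unique_least_element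
                  (fun n => Q n x)) as (n & [Hn Hmin] & _); auto.
      { intros n; apply classic. }
      exists n; split; auto; intros m Hm Hq; apply Hmin in Hq; lia.
    + intros (n & (t & _ & Ht) & _); eauto.
Qed.

Lemma mu_or_null P Q : borel P -> borel Q -> mu P = 0 -> mu Q = 0 ->
  mu (fun x => P x \/ Q x) = 0.
Proof.
  intros HP HQ H1 H2.
  rewrite (@mu_ext _ (fun x => exists b : bool, (if b then P else Q) x)).
  - apply mu_null_ex; [|intros []; auto|intros []; auto].
    exists Nat.b2n; now intros [] [].
  - intros x; split; [intros [H|H]; [exists true|exists false]; auto|].
    intros [[] H]; auto.
Qed.

Lemma mu_compl P : borel P -> mu (fun x => ~ P x) = 1 - mu P.
Proof.
  intros HP; destruct Hmu as (_ & <- & _).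
  rewrite (mu_split (borel_const HV True) HP).
  rewrite (@mu_ext (fun x => True /\ P x) P) by tauto.
  rewrite (@mu_ext (fun x => True /\ ~ P x) (fun x => ~ P x)) by tauto; lra.
Qed.

Lemma mu_minus_null P Q : borel P -> borel Q -> mu Q = 0 ->
  mu (fun x => P x /\ ~ Q x) = mu P.
Proof.
  intros HP HQ H; rewrite (mu_split HP HQ).
  rewrite (@mu_null_sub (fun x => P x /\ Q x) Q); auto; [lra| |tauto].
  now apply borel_and.
Qed.

Lemma mu_meets P Q : borel P -> borel Q -> mu P > 0 -> mu Q = 0 ->
  exists x, P x /\ ~ Q x.
Proof.
  intros HP HQ H H0; apply NNPP; intros N.
  assert (mu P = 0); [|lra].
  apply mu_null_sub with Q; auto; intros x Hx; apply NNPP; eauto.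
Qed.

(** Simple functions are formal combinations of events that may overlap; [eval] is the function
    represented. *)
Definition integral (ts : list (R * (config r V -> Prop))) : R :=
  sumR (fun t => fst t * mu (snd t)) ts.
Definition eval (ts : list (R * (config r V -> Prop))) (x : config r V) : R :=
  sumR (fun t => fst t * IZR (indZ (snd t x))) ts.

Lemma integral_ge0 ts Q : (forall t, In t ts -> borel (snd t)) ->
  borel Q -> mu Q = 0 -> (forall x, ~ Q x -> 0 <= eval ts x) -> 0 <= integral ts.
Proof.
  intros Hts HQ HQ0 H.
  (* The induction splits [B] along the first event of the list and collects in [c] the value of the
     terms already treated. At the end [c] is the value on all of [B], so that [B] is empty if [c]
     is negative. *)
  cut (forall B c, borel B -> (forall x, B x -> 0 <= c + eval ts x) ->
       0 <= c * mu B + sumR (fun t => fst t * mu (fun x => snd t x /\ B x)) ts).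
  { intros Hg; specialize (Hg _ 0 (borel_compl HQ)).
    rewrite Rmult_0_l, Rplus_0_l in Hg.
    rewrite (sumR_ext_in _ (fun t => fst t * mu (snd t))) in Hg.
    - apply Hg; intros x Hx; specialize (H x Hx); lra.
    - intros t Ht; rewrite mu_minus_null; auto. }
  clear H; induction ts as [|[a A] ts IH]; intros B c HB HBx.
  - unfold eval in HBx; simpl in *; rewrite Rplus_0_r.
    destruct (Rle_or_lt 0 c) as [Hc|Hc].
    + apply Rmult_le_pos; auto; now apply mu_ge0.
    + rewrite mu_empty; [lra|]; intros x Hx; specialize (HBx x Hx); lra.
  - assert (HA : borel A) by (apply (Hts (a, A)); simpl; auto).
    assert (Hts' : forall t, In t ts -> borel (snd t))
      by (intros; apply Hts; simpl; auto).
    assert (HA' := borel_compl HA).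
    assert (H1 := IH Hts' (fun x => B x /\ A x) (c + a) (borel_and HV HB HA)).
    assert (H2 := IH Hts' (fun x => B x /\ ~ A x) c (borel_and HV HB HA')).
    unfold eval in *; simpl in *.
    rewrite (mu_split HB HA).
    rewrite (@mu_ext (fun x => A x /\ B x) (fun x => B x /\ A x)) by tauto.
    rewrite (sumR_ext_in _ (fun t =>
      fst t * mu (fun x => snd t x /\ B x /\ A x) +
      fst t * mu (fun x => snd t x /\ B x /\ ~ A x))).
    + rewrite sumR_plus.
      enough (0 <= (c + a) * mu (fun x => B x /\ A x) +
              sumR (fun t => fst t * mu (fun x => snd t x /\ B x /\ A x)) ts /\
              0 <= c * mu (fun x => B x /\ ~ A x) +
              sumR (fun t => fst t * mu (fun x => snd t x /\ B x /\ ~ A x)) ts) by lra.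
      split.
      * apply H1; intros x [Hb Ha]; specialize (HBx x Hb).
        rewrite indZ_true in HBx by auto; lra.
      * apply H2; intros x [Hb Ha]; specialize (HBx x Hb).
        rewrite indZ_false in HBx by auto; lra.
    + intros t Ht; rewrite <- Rmult_plus_distr_l; f_equal.
      rewrite (mu_split (borel_and HV (Hts' t Ht) HB) HA).
      f_equal; apply mu_ext; intros x; tauto.
Qed.

Lemma integral_app ts ts' : integral (ts ++ ts') = integral ts + integral ts'.
Proof. apply sumR_app. Qed.

Lemma eval_app ts ts' x : eval (ts ++ ts') x = eval ts x + eval ts' x.
Proof. apply sumR_app. Qed.

Definition scale (a : R) (ts : list (R * (config r V -> Prop))) :=
  map (fun t => (a * fst t, snd t)) ts.

Lemma integral_scale a ts : integral (scale a ts) = a * integral ts.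
Proof.
  unfold integral, scale; rewrite sumR_map, <- sumR_scal.
  apply sumR_ext_in; intros t _; simpl; lra.
Qed.

Lemma eval_scale a ts x : eval (scale a ts) x = a * eval ts x.
Proof.
  unfold eval, scale; rewrite sumR_map, <- sumR_scal.
  apply sumR_ext_in; intros t _; simpl; lra.
Qed.

Lemma scale_borel a ts : (forall t, In t ts -> borel (snd t)) ->
  forall t, In t (scale a ts) -> borel (snd t).
Proof.
  intros H t Ht; apply in_map_iff in Ht as [s [<- Hs]]; simpl; auto.
Qed.

(** Used in both directions, this makes the integral independent of the representation as a formal
    combination. *)
Lemma integral_le ts ts' Q : (forall t, In t ts -> borel (snd t)) ->
  (forall t, In t ts' -> borel (snd t)) -> borel Q -> mu Q = 0 ->
  (forall x, ~ Q x -> eval ts x <= eval ts' x) -> integral ts <= integral ts'.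
Proof.
  intros H H' HQ HQ0 Hle.
  enough (0 <= integral (scale (-1) ts ++ ts'))
    by (rewrite integral_app, integral_scale in *; lra).
  apply integral_ge0 with Q; auto.
  - intros t Ht; apply in_app_or in Ht as [Ht|Ht]; auto.
    exact (scale_borel _ _ H _ Ht).
  - intros x Hx; rewrite eval_app, eval_scale; specialize (Hle x Hx); lra.
Qed.
End Measure.

(** * Gluing cells *)

Lemma classic_eq_dec (K : Type) (a b : K) : {a = b} + {a <> b}.
Proof. apply excluded_middle_informative. Qed.

Lemma sumZ_indZ_map (T K : Type) (g : T -> K) (k : K) (l : list T) :
  sumZ (fun t => indZ (g t = k)) l =
  Z.of_nat (count_occ (@classic_eq_dec K) (map g l) k).
Proof.
  induction l as [|t l IH]; auto; simpl.
  rewrite IH; unfold indZ.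
  destruct (excluded_middle_informative (g t = k)), (classic_eq_dec (g t) k);
    try tauto; lia.
Qed.

Lemma sumZ_indZ_le (T : Type) (p q : T -> Prop) (g : T -> T) (l : list T) :
  NoDup l -> (forall t u, g t = g u -> t = u) ->
  (forall t, In t l -> p t -> In (g t) l /\ q (g t)) ->
  (sumZ (fun t => indZ (p t)) l <= sumZ (fun t => indZ (q t)) l)%Z.
Proof.
  intros Hl Hg H.
  set (flt := fun s : T -> Prop => filter (fun t =>
    if excluded_middle_informative (s t) then true else false) l).
  assert (Hsum : forall s, sumZ (fun t => indZ (s t)) l = Z.of_nat (length (flt s))).
  { intros s; unfold flt; clear; induction l as [|t l IH]; auto; simpl.
    rewrite IH; unfold indZ.
    destruct (excluded_middle_informative (s t)); simpl length; lia. }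
  assert (Hin : forall s t, In t (flt s) <-> In t l /\ s t).
  { intros s t; unfold flt; rewrite filter_In.
    destruct (excluded_middle_informative (s t)); intuition discriminate. }
  rewrite !Hsum, <- (length_map g); apply inj_le, NoDup_incl_length.
  - apply FinFun.Injective_map_NoDup; [exact Hg|now apply NoDup_filter].
  - intros u Hu; apply in_map_iff in Hu as (t & <- & Ht).
    apply Hin in Ht as [Ht1 Ht2]; apply Hin; auto.
Qed.

(** The index bijections are total on [nat], being extended by the identity past the length, so that
    they can serve as invertible steps of an action. *)
Lemma permutation_index_bijection (K : Type) (a b : list K) : Permutation a b ->
  exists p q : nat -> nat, (forall k, q (p k) = k) /\ (forall k, p (q k) = k) /\
    forall k, (k < length a)%nat ->
      (p k < length a)%nat /\ (q k < length a)%nat /\ nth_error a k = nth_error b (p k).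
Proof.
  intros H; assert (Hlen := Permutation_length H).
  apply Permutation_sym, Permutation_nth_error_bis in H as (f & Hinj & Hf & H).
  rewrite <- Hlen in Hf; set (N := length a) in *.
  assert (Hsurj : FinFun.bSurjective N f).
  { apply FinFun.bInjective_bSurjective; auto; intros x y _ _; apply Hinj. }
  set (p := fun k => if k <? N then f k else k).
  assert (Hp : forall k, (k < N)%nat -> p k = f k).
  { intros k Hk; unfold p; apply Nat.ltb_lt in Hk; now rewrite Hk. }
  assert (Hp' : forall k, (N <= k)%nat -> p k = k).
  { intros k Hk; unfold p; apply Nat.ltb_ge in Hk; now rewrite Hk. }
  assert (Hq : forall k, exists j, p j = k /\ ((k < N)%nat -> (j < N)%nat)).
  { intros k; destruct (Nat.lt_ge_cases k N) as [Hk|Hk].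
    - destruct (Hsurj k Hk) as (j & Hj & <-); exists j; split; auto.
    - exists k; split; auto; lia. }
  set (q := fun k => proj1_sig (constructive_indefinite_description _ (Hq k))).
  assert (Hpq : forall k, p (q k) = k /\ ((k < N)%nat -> (q k < N)%nat)).
  { intros k; unfold q; apply proj2_sig. }
  assert (Hpinj : forall j k, p j = p k -> j = k).
  { intros j k; destruct (Nat.lt_ge_cases j N) as [Hj|Hj],
      (Nat.lt_ge_cases k N) as [Hk|Hk].
    - rewrite !Hp by auto; apply Hinj.
    - rewrite (Hp j), (Hp' k) by auto; intros <-; specialize (Hf j Hj); lia.
    - rewrite (Hp' j), (Hp k) by auto; intros ->; specialize (Hf k Hk); lia.
    - now rewrite !Hp' by auto. }
  exists p, q; split; [|split].
  - intros k; apply Hpinj, Hpq.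
  - intros k; apply Hpq.
  - intros k Hk; rewrite Hp by auto; split; [|split; [apply Hpq|]]; auto.
Qed.

Section EdgeClass.
Context {V : Type} (A : list V).

(* An edge meeting A only remembers its endpoints in A, so that the edges from A
   into the holes fall into finitely many classes; an edge inside a hole
   remembers both endpoints. *)
Definition edge_class (u w : V) : option V * option V :=
  let known v := if excluded_middle_informative (In v A) then Some v else None in
  if excluded_middle_informative (In u A \/ In w A) then (known u, known w)
  else (Some u, Some w).

(** Equal classes force [u = u'] or [w = w'], so the crossed edge from [u] to [w'] is one of the two
    given edges. This is what permits rewiring within a class. *)
Lemma edge_class_mix (P : V -> V -> Prop) (u w u' w' : V) :
  edge_class u w = edge_class u' w' -> P u w -> P u' w' -> P u w'.
Proof.
  unfold edge_class.
  repeat destruct (excluded_middle_informative _); intros H H1 H2;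
    try (injection H; clear H; intros); try discriminate; subst; tauto.
Qed.

Definition A_classes : list (option V * option V) :=
  list_prod (None :: map Some A) (None :: map Some A).

Lemma edge_class_outside (u w : V) :
  ~ In (edge_class u w) A_classes -> ~ In u A /\ ~ In w A.
Proof.
  unfold edge_class, A_classes; intros H.
  destruct (excluded_middle_informative (In u A \/ In w A)); [|tauto].
  destruct H; apply in_prod;
    destruct (excluded_middle_informative _); simpl; auto using in_map.
Qed.
End EdgeClass.

Section Gluing.
Context {r : nat} {V : Type} (E : V -> V -> letter -> Prop) (A : list V).

(** Only edges of positive letters are classified, from source to target; an inverse letter runs
    along the same edges backwards. *)
Definition out_class (x : config r V) (i : nat) (f : FG r) :=
  edge_class A (x f) (x (fg_mul f (fg_gen r (i, true)))).
Definition in_class (x : config r V) (i : nat) (f : FG r) :=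
  edge_class A (x (fg_mul f (fg_gen r (linv (i, true))))) (x f).

(** The positions in [L] are the points of the finite F-set. Equal counts make the incoming classes
    of each generator a permutation of the outgoing ones, and this permutation is the action of the
    generator; [edge_class_mix] makes the new edges legal. The result reads the labels along the
    orbit of the position of [(x0, f0)]. *)
Theorem glue (L : list (config r V * FG r)) (x0 : config r V) (f0 : FG r) :
  (forall p, In p L -> in_X E (fst p)) -> In (x0, f0) L ->
  (forall i k, (i < r)%nat ->
     sumZ (fun p => indZ (out_class (fst p) i (snd p) = k)) L =
     sumZ (fun p => indZ (in_class (fst p) i (snd p) = k)) L) ->
  exists x : config r V, in_X E x /\ periodic x /\ x (fg_id r) = x0 f0.
Proof.
  intros HX H0 Hbal.
  set (N := length L).
  set (at_ := fun k => nth k L (x0, f0)).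
  set (lab := fun k => fst (at_ k) (snd (at_ k))).
  assert (Hlab : forall k, nth_error L k = Some (at_ k) \/ (N <= k)%nat).
  { intros k; destruct (Nat.lt_ge_cases k N); auto; left; now apply nth_error_nth'. }
  assert (Hperm : forall i, exists pq : (nat -> nat) * (nat -> nat),
     (forall k, snd pq (fst pq k) = k) /\ (forall k, fst pq (snd pq k) = k) /\
     forall k, (k < N)%nat -> (fst pq k < N)%nat /\ (snd pq k < N)%nat /\
       ((i < r)%nat -> E (lab k) (lab (fst pq k)) (i, true) /\
                E (lab (fst pq k)) (lab k) (i, false))).
  { intros i; destruct (Nat.lt_ge_cases i r) as [Hi|Hi];
      [|exists (fun k => k, fun k => k); simpl; intuition; lia].
    destruct (@permutation_index_bijection _
      (map (fun p => out_class (fst p) i (snd p)) L)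
      (map (fun p => in_class (fst p) i (snd p)) L)) as (p & q & Hqp & Hpq & H).
    { apply (Permutation_count_occ (@classic_eq_dec _)); intros k.
      apply Nat2Z.inj; rewrite <- !sumZ_indZ_map; now apply Hbal. }
    exists (p, q); simpl; split; [|split]; auto.
    intros k Hk; rewrite length_map in H; destruct (H k Hk) as (H1 & H2 & H3).
    split; [|split]; auto; intros _.
    destruct (Hlab k) as [Ek|]; [|lia].
    destruct (Hlab (p k)) as [Ep|]; [|unfold N in *; lia].
    rewrite !nth_error_map, Ek, Ep in H3; simpl in H3; injection H3 as H3.
    assert (Xk := HX _ (nth_error_In _ _ Ek)).
    assert (Xp := HX _ (nth_error_In _ _ Ep)).
    assert (Hr : in_rank r (i, true) = true) by now apply Nat.ltb_lt.
    (* Both orientations of an edge are carried through the rewiring together, as [E] constrains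
       each of them. *)
    apply (edge_class_mix A
      (fun u w => E u w (i, true) /\ E w u (linv (i, true)))) with (1 := H3).
    - split; [now apply Xk|].
      rewrite <- (mul_gen_linv (snd (at_ k)) (i, true)) at 2 by auto.
      now apply Xk.
    - split; [|now apply Xp].
      rewrite <- (mul_linv_gen (snd (at_ (p k))) (i, true)) at 2 by auto.
      now apply Xp. }
  set (pq := fun i => proj1_sig (constructive_indefinite_description _ (Hperm i))).
  assert (Hpq := fun i => proj2_sig (constructive_indefinite_description _ (Hperm i))).
  change (forall i,
     (forall k, snd (pq i) (fst (pq i) k) = k) /\
     (forall k, fst (pq i) (snd (pq i) k) = k) /\
     forall k, (k < N)%nat -> (fst (pq i) k < N)%nat /\ (snd (pq i) k < N)%nat /\
       ((i < r)%nat -> E (lab k) (lab (fst (pq i) k)) (i, true) /\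
                E (lab (fst (pq i) k)) (lab k) (i, false))) in Hpq.
  clearbody pq.
  set (step := fun (a : letter) k =>
    if snd a then fst (pq (fst a)) k else snd (pq (fst a)) k).
  assert (Hstep : forall a k, step (linv a) (step a k) = k).
  { intros [i []] k; unfold step; simpl; apply Hpq. }
  assert (HstepN : forall a k, (k < N)%nat -> (step a k < N)%nat).
  { intros [i []] k Hk; unfold step; simpl; now apply Hpq. }
  assert (HE : forall a k, (k < N)%nat -> in_rank r a = true ->
                E (lab k) (lab (step a k)) a).
  { intros [i b] k Hk Hr; apply Nat.ltb_lt in Hr; simpl in Hr.
    destruct (Hpq i) as (H1 & H2 & H3).
    destruct b; unfold step; simpl; [now apply H3|].
    destruct (H3 k Hk) as (_ & Hk' & _).
    destruct (H3 _ Hk') as (_ & _ & H4); rewrite H2 in H4; now apply H4. }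
  apply In_nth_error in H0 as [k0 Hk0].
  assert (Hk0N : (k0 < N)%nat) by (apply nth_error_Some; congruence).
  assert (Hact : forall w, (word_act step k0 w < N)%nat).
  { intros w; clear Hk0; revert k0 Hk0N.
    induction w as [|a w IH]; intros k0 Hk0N; simpl; auto. }
  exists (fun g => lab (word_act step k0 (proj1_sig g))); split; [|split].
  - intros f s Hs; rewrite word_act_mul, word_gen by auto; simpl; auto.
  (* One coset representative for each point of the orbit of [k0]; for points off the orbit
     [epsilon] returns an arbitrary element. *)
  - set (good := fun k (t : FG r) => word_act step k0 (proj1_sig t) = k).
    exists (map (fun k => epsilon (inhabits (fg_id r)) (good k)) (seq 0 N)).
    intros g; set (k := word_act step k0 (proj1_sig g)).
    exists (epsilon (inhabits (fg_id r)) (good k)); split.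
    + apply (in_map (fun k => epsilon (inhabits (fg_id r)) (good k))), in_seq.
      specialize (Hact (proj1_sig g)); fold k in Hact; lia.
    + assert (Ht : good k (epsilon (inhabits (fg_id r)) (good k))).
      { apply epsilon_spec; now exists g. }
      (* The shifted configuration reads at [u] the point reached by the product of [t], the inverse
         of [g], and [u]. Since [t] and [g] lead [k0] to the same point, [t] may be replaced by [g],
         which cancels. *)
      set (t := epsilon _ _) in *; intros u; unfold shift.
      apply (f_equal lab); rewrite inv_mul, inv_inv, mul_assoc, word_act_mul by auto.
      rewrite Ht; unfold k; rewrite <- word_act_mul by auto.
      now rewrite mul_invr_assoc.
  - simpl; unfold lab, at_; now rewrite (nth_error_nth _ _ _ Hk0).
Qed.

Definition flow (x : config r V) (c : nat * (option V * option V)) (f : FG r) : Z :=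
  (indZ (out_class x (fst c) f = snd c) - indZ (in_class x (fst c) f = snd c))%Z.

Definition coords : list (nat * (option V * option V)) :=
  list_prod (seq 0 r) (A_classes A).

(** No edge with both endpoints outside [A] leaves [D]. *)
Definition hole_closed (x : config r V) (D : list (FG r)) : Prop :=
  forall f s, in_rank r s = true -> In f D -> ~ In (x f) A ->
    ~ In (x (fg_mul f (fg_gen r s))) A -> In (fg_mul f (fg_gen r s)) D.

(** An edge of such a class runs inside a hole, so it has both ends in [D] or neither. Translation
    by the generator then matches the edges leaving points of [D] with those entering. Hence only
    the finitely many [coords] need balancing. *)
Lemma flow_outside (x : config r V) (D : list (FG r)) (i : nat) k :
  (i < r)%nat -> NoDup D -> hole_closed x D -> ~ In k (A_classes A) ->
  sumZ (flow x (i, k)) D = 0%Z.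
Proof.
  intros Hi HD Hx Hk.
  assert (Hr : in_rank r (i, true) = true) by now apply Nat.ltb_lt.
  assert (Hsub : sumZ (flow x (i, k)) D =
    (sumZ (fun f => indZ (out_class x i f = k)) D -
     sumZ (fun f => indZ (in_class x i f = k)) D)%Z).
  { clear; unfold flow; simpl; induction D; simpl; lia. }
  rewrite Hsub; apply Z.sub_move_0_r, Z.le_antisymm.
  - apply sumZ_indZ_le with (fun f => fg_mul f (fg_gen r (i, true))); auto.
    + intros f g H; now rewrite <- (mul_gen_linv f (i, true)), H, mul_gen_linv.
    + intros f Hf <-; apply edge_class_outside in Hk as [H1 H2]; split; auto.
      unfold in_class; now rewrite mul_gen_linv.
  - apply sumZ_indZ_le with (fun f => fg_mul f (fg_gen r (linv (i, true)))); auto.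
    + intros f g H; now rewrite <- (mul_linv_gen f (i, true)), H, mul_linv_gen.
    + intros f Hf <-; apply edge_class_outside in Hk as [H1 H2]; split; auto.
      unfold out_class; now rewrite mul_linv_gen.
Qed.

Theorem glue_patches (l : list (config r V * list (FG r))) x0 D0 f0 :
  (forall x D, In (x, D) l -> in_X E x /\ NoDup D /\ hole_closed x D) ->
  In (x0, D0) l -> In f0 D0 ->
  (forall c, In c coords ->
     sumZ (fun p => sumZ (flow (fst p) c) (snd p)) l = 0%Z) ->
  exists x : config r V, in_X E x /\ periodic x /\ x (fg_id r) = x0 f0.
Proof.
  intros Hl Hx0 Hf0 Hbal.
  apply glue with (L := flat_map (fun p => map (pair (fst p)) (snd p)) l).
  - intros p Hp; apply in_flat_map in Hp as ([x D] & H & Hp).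
    apply in_map_iff in Hp as (f & <- & _); now apply Hl in H.
  - apply in_flat_map; exists (x0, D0); split; auto; now apply in_map.
  - intros i k Hi; rewrite !sumZ_flat_map.
    assert (H : sumZ (fun p => sumZ (flow (fst p) (i, k)) (snd p)) l = 0%Z).
    { destruct (classic (In k (A_classes A))) as [Hk|Hk].
      - apply Hbal, in_prod; auto; apply in_seq; lia.
      - rewrite (sumZ_ext_in _ (fun _ => 0%Z)).
        + clear; induction l; simpl; auto.
        + intros [x D] H; apply Hl in H; now apply flow_outside. }
    clear -H; revert H.
    match goal with |- _ -> ?a = ?b => enough
      (sumZ (fun p => sumZ (flow (fst p) (i, k)) (snd p)) l = (a - b)%Z) by lia end.
    induction l as [|[x D] l IH]; auto; simpl; rewrite IH, !sumZ_map; clear; simpl.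
    enough (sumZ (flow x (i, k)) D =
      (sumZ (fun f => indZ (out_class x i f = k)) D -
       sumZ (fun f => indZ (in_class x i f = k)) D)%Z) by lia.
    unfold flow; simpl; induction D; simpl; lia.
Qed.
End Gluing.

(** * Cells and mass transport *)

Lemma sumZ_Permutation (T : Type) (f : T -> Z) (l l' : list T) :
  Permutation l l' -> sumZ f l = sumZ f l'.
Proof. induction 1; simpl; lia. Qed.

Lemma finite_enumeration (T : Type) (P : T -> Prop) (l : list T) :
  (forall t, P t -> In t l) -> exists D, NoDup D /\ forall t, In t D <-> P t.
Proof.
  intros H.
  exists (nodup (@classic_eq_dec T) (filter (fun t =>
    if excluded_middle_informative (P t) then true else false) l)).
  split; [apply NoDup_nodup|intros t]; rewrite nodup_In, filter_In.
  specialize (H t); destruct (excluded_middle_informative (P t)); intuition discriminate.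
Qed.

Lemma sumZ_support (T : Type) (f : T -> Z) (B D : list T) :
  NoDup B -> NoDup D -> incl D B -> (forall t, In t B -> ~ In t D -> f t = 0%Z) ->
  sumZ f B = sumZ f D.
Proof.
  intros HB HD Hi H0.
  set (flt := filter (fun t =>
    if excluded_middle_informative (In t D) then true else false) B).
  transitivity (sumZ f flt).
  - unfold flt; clear -H0; induction B as [|t B IH]; auto; simpl.
    rewrite IH by (intros; apply H0; simpl; auto).
    destruct (excluded_middle_informative (In t D)); auto.
    rewrite (H0 t); simpl; auto.
  - apply sumZ_Permutation, NoDup_Permutation; auto; [now apply NoDup_filter|].
    intros t; unfold flt; rewrite filter_In.
    destruct (excluded_middle_informative (In t D)) as [Ht|Ht].
    + specialize (Hi t Ht); tauto.
    + intuition discriminate.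
Qed.

(** * Paths in the Cayley graph *)

Section Reach.
Context {r : nat}.
Implicit Types (C : FG r -> Prop) (f g h : FG r).

Lemma reach_l C f g : reach C f g -> C f.
Proof. induction 1; auto. Qed.

Lemma reach_r C f g : reach C f g -> C g.
Proof. induction 1; auto. Qed.

Lemma reach_trans C f g h : reach C f g -> reach C g h -> reach C f h.
Proof. intros H; induction 1; auto; now apply reach_step. Qed.

Lemma reach_sym C f g : reach C f g -> reach C g f.
Proof.
  induction 1 as [H|h s H IH Hs Hc]; [now apply reach_refl|].
  apply reach_trans with h; auto.
  rewrite <- (mul_gen_linv h s) at 2 by auto.
  apply reach_step; [now apply reach_refl|auto|].
  rewrite mul_gen_linv by auto; now apply reach_r in H.
Qed.

Lemma reach_map C C' k f g : (forall u, C u -> C' (fg_mul k u)) ->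
  reach C f g -> reach C' (fg_mul k f) (fg_mul k g).
Proof.
  intros Hk; induction 1 as [H|h s H IH Hs Hc]; [apply reach_refl; auto|].
  rewrite <- mul_assoc; apply reach_step; auto; rewrite mul_assoc; auto.
Qed.

Lemma reach_within C f g : reach C f g -> reach (reach C f) f g.
Proof.
  induction 1 as [H|h s H IH Hs Hc]; [now apply reach_refl, reach_refl|].
  apply reach_step; auto; now apply reach_step.
Qed.

Lemma reach_S_component C f : C f -> S_component C (reach C f).
Proof.
  intros Hf; repeat split.
  - exists f; now apply reach_refl.
  - intros g; apply reach_r.
  - intros g h Hg Hh; apply reach_trans with f.
    + apply reach_sym; now apply reach_within.
    + now apply reach_within.
  - intros C' HC HC' HS g Hg.
    assert (H : reach C' f g) by (apply HS; auto; now apply HC, reach_refl).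
    induction H; [now apply reach_refl|apply reach_step; auto].
    apply IHreach; now apply reach_r in H.
Qed.

(** Paths graded by length, with the last step as an existential over a countable type, so that
    reachability is a Borel event. *)
Fixpoint reach_in C f (n : nat) : FG r -> Prop :=
  match n with
  | O => fun g => C f /\ f = g
  | S n => fun g => exists p : FG r * letter, reach_in C f n (fst p) /\
      in_rank r (snd p) = true /\ C g /\ fg_mul (fst p) (fg_gen r (snd p)) = g
  end.

Lemma reach_in_iff C f g : reach C f g <-> exists n, reach_in C f n g.
Proof.
  split.
  - induction 1 as [H|h s H [n IH] Hs Hc]; [exists 0%nat; simpl; auto|].
    exists (S n), (h, s); simpl; auto.
  - intros [n H]; revert g H; induction n as [|n IH]; simpl.
    + intros g [H <-]; now apply reach_refl.
    + intros g ([h s] & H1 & H2 & H3 & <-); apply reach_step; auto.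
Qed.
End Reach.

(** Shifting by the inverse of [f] re-roots [x] at [f]; all re-rooting below has this form. *)
Lemma shift_inv (r : nat) (V : Type) (x : config r V) (f u : FG r) :
  shift (fg_inv f) x u = x (fg_mul f u).
Proof. unfold shift; now rewrite inv_inv. Qed.

Lemma shift_inv_shift (r : nat) (V : Type) (x : config r V) (f : FG r) :
  shift (fg_inv (fg_inv f)) (shift (fg_inv f) x) = x.
Proof.
  extensionality u; rewrite !shift_inv; now rewrite mul_invr_assoc.
Qed.

Lemma borel_shift (r : nat) (V : Type) (g : FG r) (P : config r V -> Prop) :
  borel P -> borel (fun x => P (shift g x)).
Proof.
  induction 1 as [f v|P HP IH|P HP IH].
  - exact (borel_cyl (fg_mul (fg_inv g) f) v).
  - exact (borel_compl IH).
  - exact (borel_union (fun n x => P n (shift g x)) IH).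
Qed.

Section Cells.
Context {r : nat} {V : Type} (A : list V).
Implicit Types (x : config r V) (f g : FG r) (D : list (FG r)).

(** At a point with label in [A] the second alternative is impossible, so the cell is a
    singleton. *)
Definition cell x f g : Prop := f = g \/ reach (fun u => ~ In (x u) A) f g.

Lemma cell_sym x f g : cell x f g -> cell x g f.
Proof. intros [->|H]; [now left|right; now apply reach_sym]. Qed.

Lemma cell_trans x f g h : cell x f g -> cell x g h -> cell x f h.
Proof.
  intros [->|H] [<-|H']; try solve [now left | now right].
  right; now apply reach_trans with g.
Qed.

Lemma cell_step x f s : in_rank r s = true -> ~ In (x f) A ->
  ~ In (x (fg_mul f (fg_gen r s))) A -> cell x f (fg_mul f (fg_gen r s)).
Proof. intros; right; apply reach_step; auto; now apply reach_refl. Qed.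

Lemma cell_shift x f u w :
  cell (shift (fg_inv f) x) u w <-> cell x (fg_mul f u) (fg_mul f w).
Proof.
  split; intros [H|H].
  - left; now rewrite H.
  - right; revert H; apply reach_map; intros v; now rewrite shift_inv.
  - left; exact (mul_cancel_l H).
  - right; rewrite <- (mul_invl_assoc f u), <- (mul_invl_assoc f w).
    revert H; apply reach_map; intros v; now rewrite shift_inv, mul_invr_assoc.
Qed.

Definition is_cell x D : Prop :=
  NoDup D /\ forall f, In f D <-> cell x (fg_id r) f.

Lemma is_cell_id x D : is_cell x D -> In (fg_id r) D.
Proof. intros [_ H]; apply H; now left. Qed.

Lemma is_cell_hole_closed x D : is_cell x D -> hole_closed A x D.
Proof.
  intros [_ H] f s Hs Hf H1 H2; apply H; apply H in Hf.
  apply cell_trans with f; auto; now apply cell_step.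
Qed.

Lemma is_cell_exists x :
  (forall C, S_component (fun f => ~ In (x f) A) C -> finite_set C) ->
  exists D, is_cell x D.
Proof.
  intros H; destruct (classic (In (x (fg_id r)) A)) as [Hx|Hx].
  - apply (finite_enumeration _ [fg_id r]).
    intros f [<-|Hf]; simpl; auto; now apply reach_l in Hf.
  - destruct (H _ (reach_S_component _ _ Hx)) as [l Hl].
    apply (finite_enumeration _ l); intros f [<-|Hf]; apply Hl; auto.
    now apply reach_refl.
Qed.

Lemma is_cell_shift x D f : is_cell x D -> In f D ->
  is_cell (shift (fg_inv f) x) (map (fg_mul (fg_inv f)) D).
Proof.
  intros [HD H] Hf; split.
  - apply FinFun.Injective_map_NoDup; auto; intros g h; apply mul_cancel_l.
  - intros g; rewrite cell_shift, mul_1r, in_map_iff.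
    transitivity (In (fg_mul f g) D).
    + split.
      * intros (h & <- & Hh); now rewrite mul_invr_assoc.
      * intros Hg; exists (fg_mul f g); split; auto; apply mul_invl_assoc.
    + rewrite H; apply H in Hf; split; intros Hg.
      * apply cell_trans with (fg_id r); auto; now apply cell_sym.
      * now apply cell_trans with f.
Qed.

Section Key.
Variable enc : FG r -> nat.

(** The largest code of a quotient of two points, not a word length: it is invariant under left
    translation, and once [enc] is injective it bounds finitely many quotients. *)
Definition diameter D : nat := list_max
  (map (fun p => enc (fg_mul (fg_inv (fst p)) (snd p))) (list_prod D D)).

Lemma diameter_ge D f g : In f D -> In g D ->
  (enc (fg_mul (fg_inv f) g) <= diameter D)%nat.
Proof.
  intros Hf Hg; unfold diameter.
  assert (H := proj1 (list_max_le _ _) (Nat.le_refl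
    (list_max (map (fun p => enc (fg_mul (fg_inv (fst p)) (snd p))) (list_prod D D))))).
  rewrite Forall_forall in H; apply H, in_map_iff.
  exists (f, g); split; auto; now apply in_prod.
Qed.

Lemma diameter_le D D' h : (forall f, In f D -> In (fg_mul h f) D') ->
  (diameter D <= diameter D')%nat.
Proof.
  intros H; apply list_max_le, Forall_forall; intros n Hn.
  apply in_map_iff in Hn as ([f g] & <- & Hp); apply in_prod_iff in Hp as [Hf Hg].
  simpl; rewrite <- (mul_invl_assoc h g), <- mul_assoc, <- inv_mul.
  apply diameter_ge; auto.
Qed.

(* A countable translation-invariant datum that bounds the shape of a cell, so
   that re-rooting on the event [has_key k] involves finitely many translations. *)
Definition key D : nat := to_nat (diameter D, length D).

Lemma key_translate D D' h : NoDup D -> NoDup D' ->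
  (forall f, In f D <-> In (fg_mul h f) D') -> key D = key D'.
Proof.
  intros HD HD' H.
  assert (H' : forall f, In f D' -> In (fg_mul (fg_inv h) f) D).
  { intros f Hf; apply H; now rewrite mul_invr_assoc. }
  unfold key; do 2 f_equal; apply Nat.le_antisymm.
  - apply diameter_le with h; intros f; apply H.
  - apply diameter_le with (fg_inv h); auto.
  - rewrite <- (length_map (fg_mul h)); apply NoDup_incl_length.
    + apply FinFun.Injective_map_NoDup; auto; intros f g; apply mul_cancel_l.
    + intros f Hf; apply in_map_iff in Hf as (g & <- & Hg); now apply H.
  - rewrite <- (length_map (fg_mul (fg_inv h))); apply NoDup_incl_length.
    + apply FinFun.Injective_map_NoDup; auto; intros f g; apply mul_cancel_l.
    + intros f Hf; apply in_map_iff in Hf as (g & <- & Hg); auto.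
Qed.

Definition has_key (k : nat) x : Prop := exists D, is_cell x D /\ key D = k.

Lemma key_unique x D D' : is_cell x D -> is_cell x D' -> key D = key D'.
Proof.
  intros [HD H] [HD' H']; apply key_translate with (fg_id r); auto.
  intros f; now rewrite mul_1l, H, H'.
Qed.

(** Re-rooting is an involution on pairs of a configuration and a point of its root cell, taking the
    point to its inverse. Mass transport rests on this symmetry. *)
Lemma has_key_shift k x f : has_key k x /\ cell x (fg_id r) f ->
  has_key k (shift (fg_inv f) x) /\
  cell (shift (fg_inv f) x) (fg_id r) (fg_inv f).
Proof.
  intros [(D & HD & <-) Hf]; split.
  - apply HD in Hf; exists (map (fg_mul (fg_inv f)) D).
    assert (HD' := is_cell_shift f HD Hf); split; auto.
    symmetry; apply key_translate with (fg_inv f); [apply HD|apply HD'|].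
    intros g; split; [apply in_map|intros Hg].
    apply in_map_iff in Hg as (h & Hh & Hh'); apply mul_cancel_l in Hh; now subst.
  - apply cell_shift; rewrite mul_1r, mul_invr; now apply cell_sym.
Qed.

Lemma has_key_shift_iff k x f :
  has_key k (shift (fg_inv f) x) /\
  cell (shift (fg_inv f) x) (fg_id r) (fg_inv f) <->
  has_key k x /\ cell x (fg_id r) f.
Proof.
  split; [|apply has_key_shift].
  intros H; apply has_key_shift in H; now rewrite shift_inv_shift, inv_inv in H.
Qed.

Hypothesis enc_inj : forall f g, enc f = enc g -> f = g.

Lemma ball_exists (n : nat) :
  exists B, NoDup B /\ forall f, In f B <-> (enc f <= n)%nat.
Proof.
  apply (finite_enumeration _ (map (fun j =>
    epsilon (inhabits (fg_id r)) (fun f => enc f = j)) (seq 0 (S n)))).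
  intros f Hf; apply in_map_iff; exists (enc f); split; [|apply in_seq; lia].
  apply enc_inj, (epsilon_spec (inhabits (fg_id r)) (fun g => enc g = enc f)).
  now exists f.
Qed.

(** The first component decoded from a key is the diameter. The ball thus holds all root cells with
    key [k] and the inverses of their points, these being quotients with the root. *)
Definition ball (k : nat) : list (FG r) := proj1_sig
  (constructive_indefinite_description _ (ball_exists (fst (of_nat k)))).

Lemma ball_spec k : NoDup (ball k) /\
  forall f, In f (ball k) <-> (enc f <= fst (of_nat k))%nat.
Proof. unfold ball; apply proj2_sig. Qed.

Lemma cell_in_ball x D f : is_cell x D -> In f D ->
  In f (ball (key D)) /\ In (fg_inv f) (ball (key D)).
Proof.
  intros HD Hf; assert (H1 := is_cell_id HD).
  assert (E : fst (of_nat (key D)) = diameter D)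
    by (unfold key; now rewrite cancel_of_to).
  split; apply ball_spec; rewrite E.
  - rewrite <- (mul_invl_assoc (fg_id r) f), (mul_1l f); now apply diameter_ge.
  - rewrite <- (mul_1r (fg_inv f)); now apply diameter_ge.
Qed.

(** The number of points of the root cell at which [p] holds after re-rooting, on the event that the
    cell has key [k]. *)
Definition spread (k : nat) (p : config r V -> Prop) :=
  map (fun f => (1, fun x => (has_key k x /\ cell x (fg_id r) f) /\
                             p (shift (fg_inv f) x))) (ball k).

(** The terms of [spread] seen from the other end: on the same event, the size of the cell times the
    indicator of [p] at the root. *)
Definition gather (k : nat) (p : config r V -> Prop) :=
  map (fun f => (1, fun x => (has_key k x /\ cell x (fg_id r) (fg_inv f)) /\ p x))
      (ball k).

Lemma eval_unit (F : FG r -> config r V -> Prop) (l : list (FG r)) x :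
  eval (map (fun f => (1, F f)) l) x = IZR (sumZ (fun f => indZ (F f x)) l).
Proof.
  unfold eval; rewrite sumR_map; simpl.
  induction l as [|f l IH]; auto; simpl; rewrite IH, plus_IZR; lra.
Qed.

Lemma eval_spread (p : config r V -> Prop) x D : is_cell x D ->
  eval (spread (key D) p) x =
  IZR (sumZ (fun f => indZ (p (shift (fg_inv f) x))) D).
Proof.
  intros HD; unfold spread; rewrite eval_unit; f_equal.
  rewrite (@sumZ_support _ _ (ball (key D)) D).
  - apply sumZ_ext_in; intros f Hf; apply indZ_iff.
    apply HD in Hf; split; [tauto|]; intros Hp; repeat split; auto.
    now exists D.
  - apply ball_spec.
  - apply HD.
  - intros f Hf; exact (proj1 (cell_in_ball _ HD Hf)).
  - intros f _ Hf; apply indZ_false; intros [[_ H] _]; now apply HD in H.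
Qed.

Lemma eval_gather (p : config r V -> Prop) x D : is_cell x D ->
  eval (gather (key D) p) x = INR (length D) * IZR (indZ (p x)).
Proof.
  intros HD; unfold gather; rewrite eval_unit, INR_IZR_INZ, <- mult_IZR; f_equal.
  rewrite (@sumZ_support _ _ (ball (key D)) (map (@fg_inv r) D)).
  - rewrite sumZ_map, (sumZ_ext_in _ (fun _ => indZ (p x))).
    + clear; induction D; [auto|]; simpl sumZ; rewrite IHD; simpl length; lia.
    + intros f Hf; apply indZ_iff; rewrite inv_inv.
      apply HD in Hf; split; [tauto|]; intros Hp; repeat split; auto.
      now exists D.
  - apply ball_spec.
  - apply FinFun.Injective_map_NoDup; [|apply HD].
    intros f g H; now rewrite <- (inv_inv f), H, inv_inv.
  - intros f Hf; apply in_map_iff in Hf as (g & <- & Hg).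
    exact (proj2 (cell_in_ball _ HD Hg)).
  - intros f _ Hf; apply indZ_false; intros [[_ H] _]; apply Hf.
    apply HD in H; apply in_map_iff; exists (fg_inv f); now rewrite inv_inv.
Qed.

Lemma eval_no_key k (F : FG r -> config r V -> Prop) (l : list (FG r)) x :
  (forall f, F f x -> has_key k x) -> ~ has_key k x ->
  eval (map (fun f => (1, F f)) l) x = 0.
Proof.
  intros HF Hx; rewrite eval_unit; apply (f_equal IZR).
  induction l as [|f l IH]; auto; simpl; rewrite IH, indZ_false; firstorder.
Qed.

Hypothesis HC : countable V.
Hypothesis HV : inhabited V.

Lemma borel_cell f g : borel (fun x => cell x f g).
Proof.
  apply (borel_or HV); [now apply borel_const|].
  apply borel_ext with (fun x => exists n, reach_in (fun u => ~ In (x u) A) f n g).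
  { intros x; now rewrite reach_in_iff. }
  apply (borel_ex HV); [apply countable_nat|intros n]; revert g.
  induction n as [|n IH]; intros g; simpl.
  - apply (borel_and HV); [|now apply borel_const].
    apply (borel_coord HV HC (fun v => ~ In v A)).
  - apply (borel_ex HV);
      [apply countable_prod; [apply countable_FG|apply countable_letter]|].
    intros p; apply (borel_and HV); auto; apply (borel_and HV); [now apply borel_const|].
    apply (borel_and HV); [|now apply borel_const].
    apply (borel_coord HV HC (fun v => ~ In v A)).
Qed.

Lemma borel_is_cell D : borel (fun x => is_cell x D).
Proof.
  apply (borel_and HV); [now apply borel_const|].
  apply (borel_all HV); [apply countable_FG|intros f].
  apply (borel_iff HV); [now apply borel_const|apply borel_cell].
Qed.

Lemma borel_has_key k : borel (has_key k).
Proof.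
  apply (borel_ex HV); [apply countable_list, countable_FG|intros D].
  apply (borel_and HV); [apply borel_is_cell|now apply borel_const].
Qed.

Lemma borel_spread k p : borel p -> forall t, In t (spread k p) -> borel (snd t).
Proof.
  intros Hp t Ht; apply in_map_iff in Ht as (f & <- & _); simpl.
  apply (borel_and HV); [|now apply borel_shift].
  apply (borel_and HV); [apply borel_has_key|apply borel_cell].
Qed.

Lemma borel_gather k p : borel p -> forall t, In t (gather k p) -> borel (snd t).
Proof.
  intros Hp t Ht; apply in_map_iff in Ht as (f & <- & _); simpl.
  apply (borel_and HV); auto.
  apply (borel_and HV); [apply borel_has_key|apply borel_cell].
Qed.

Context (mu : (config r V -> Prop) -> R).
Hypothesis Hmu : prob_measure mu.
Hypothesis Hinv : shift_invariant mu.

(** Shift invariance and the re-rooting symmetry turn each term of [spread] into the matching term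
    of [gather]. The latter function is [p] times the size of the cell, which is the second
    component of the key. *)
Lemma mass_transport k p : borel p ->
  integral mu (spread k p) = INR (snd (of_nat k)) * mu (fun x => has_key k x /\ p x).
Proof.
  intros Hp.
  assert (Hkp : borel (fun x => has_key k x /\ p x))
    by (apply (borel_and HV); auto; apply borel_has_key).
  transitivity (integral mu (gather k p)).
  - unfold integral, spread, gather; rewrite !sumR_map; apply sumR_ext_in.
    intros f _; simpl; f_equal.
    rewrite <- (Hinv (fg_inv f)
      (A := fun x => (has_key k x /\ cell x (fg_id r) (fg_inv f)) /\ p x)).
    + apply mu_ext; intros x; now rewrite has_key_shift_iff.
    + apply (borel_and HV); auto.
      apply (borel_and HV); [apply borel_has_key|apply borel_cell].
  - set (single := [(INR (snd (of_nat k)), fun x => has_key k x /\ p x)]).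
    assert (Hs : forall t, In t single -> borel (snd t)) by (intros t [<-|[]]; auto).
    assert (He : forall x, eval (gather k p) x = eval single x).
    { intros x; unfold single, eval at 2; simpl; rewrite Rplus_0_r.
      destruct (classic (has_key k x)) as [Hx|Hx].
      - destruct Hx as (D & HD & <-); rewrite (eval_gather _ HD).
        unfold key at 1; rewrite cancel_of_to; simpl; do 2 f_equal.
        apply indZ_iff; split; [|tauto]; split; auto; now exists D.
      - rewrite indZ_false by tauto; unfold gather.
        rewrite (@eval_no_key k); auto; [lra|tauto]. }
    replace (INR _ * _) with (integral mu single) by (unfold integral; simpl; lra).
    assert (Hg := borel_gather k Hp).
    assert (H1 := borel_const (r := r) HV False).
    assert (H2 := mu_empty HV Hmu (fun _ => False) (fun _ H => H)).
    apply Rle_antisym.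
    + apply (integral_le HV Hmu _ _ Hg Hs H1 H2); intros x _; rewrite He; lra.
    + apply (integral_le HV Hmu _ _ Hs Hg H1 H2); intros x _; rewrite He; lra.
Qed.

(** Almost surely the root cell is finite and so has exactly one key; the keys partition [p] up to a
    null set. *)
Lemma key_series (p : config r V -> Prop) : borel p ->
  mu (fun x => ~ exists D, is_cell x D) = 0 ->
  is_series (fun k => mu (fun x => has_key k x /\ p x)) (mu p).
Proof.
  intros Hp H0.
  assert (Hex : borel (fun x => exists D, is_cell x D)).
  { apply (borel_ex HV); [apply countable_list, countable_FG|apply borel_is_cell]. }
  rewrite <- (mu_minus_null HV Hmu Hp (borel_compl Hex) H0).
  rewrite (@mu_ext _ _ mu _ (fun x => exists k, has_key k x /\ p x)).
  - apply (mu_series Hmu).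
    + intros k; apply (borel_and HV); auto; apply borel_has_key.
    + intros k m x Hkm [(D & HD & <-) _] [(D' & HD' & <-) _].
      apply Hkm; eapply key_unique; eauto.
  - intros x; split.
    + intros [Hx Hn]; apply NNPP in Hn as [D HD]; exists (key D); split; auto.
      now exists D.
    + intros (k & (D & HD & _) & Hx); split; auto; intros Hn; apply Hn; eauto.
Qed.

(** Re-rooting at the source of the edge that enters the identity makes it the edge that leaves the
    identity. *)
Lemma out_in_mu (i : nat) kappa : (i < r)%nat ->
  mu (fun x => out_class A x i (fg_id r) = kappa) =
  mu (fun x => in_class A x i (fg_id r) = kappa).
Proof.
  intros Hi; set (t := fg_mul (fg_id r) (fg_gen r (linv (i, true)))).
  rewrite <- (Hinv (fg_inv t) (A := fun x => out_class A x i (fg_id r) = kappa)).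
  - apply mu_ext; intros x; unfold out_class, in_class.
    rewrite !shift_inv, mul_1r, mul_1l; fold t.
    replace (fg_mul t (fg_gen r (i, true))) with (fg_id r); [tauto|].
    symmetry; apply mul_linv_gen; now apply Nat.ltb_lt.
  - apply (borel_coord2 HV HC (fun u w => edge_class A u w = kappa)).
Qed.

Lemma borel_out (i : nat) kappa f : borel (fun x => out_class A x i f = kappa).
Proof. apply (borel_coord2 HV HC (fun u w => edge_class A u w = kappa)). Qed.

Lemma borel_in (i : nat) kappa f : borel (fun x => in_class A x i f = kappa).
Proof. apply (borel_coord2 HV HC (fun u w => edge_class A u w = kappa)). Qed.

(** A simple function: the functional [ps] applied to the flow vector of the whole root cell if that
    cell has key [k], and 0 otherwise. *)
Definition flow_terms (k : nat) (ps : list (R * (nat * (option V * option V)))) :=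
  flat_map (fun q =>
    scale (fst q) (spread k (fun x =>
      out_class A x (fst (snd q)) (fg_id r) = snd (snd q))) ++
    scale (- fst q) (spread k (fun x =>
      in_class A x (fst (snd q)) (fg_id r) = snd (snd q)))) ps.

Lemma borel_flow_terms k ps t : In t (flow_terms k ps) -> borel (snd t).
Proof.
  intros Ht; apply in_flat_map in Ht as (q & _ & Ht).
  apply in_app_or in Ht as [Ht|Ht]; revert t Ht; apply scale_borel, borel_spread;
    auto using borel_out, borel_in.
Qed.

Lemma eval_flow_terms ps x D : is_cell x D ->
  eval (flow_terms (key D) ps) x = lin ps (fun c => sumZ (flow A x c) D).
Proof.
  intros HD; unfold lin; induction ps as [|[a [i kappa]] ps IH]; [reflexivity|].
  unfold flow_terms; simpl; fold (flow_terms (key D) ps).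
  rewrite !eval_app, !eval_scale, !eval_spread, IH by auto.
  replace (sumZ (flow A x (i, kappa)) D) with
    (sumZ (fun f => indZ (out_class A x i f = kappa)) D -
     sumZ (fun f => indZ (in_class A x i f = kappa)) D)%Z
    by (unfold flow; simpl; clear; induction D; simpl; lia).
  rewrite minus_IZR.
  rewrite (sumZ_ext_in _ (fun f => indZ (out_class A x i f = kappa))).
  - rewrite (sumZ_ext_in (fun f => indZ (in_class A (shift _ _) _ _ = _))
               (fun f => indZ (in_class A x i f = kappa))); [simpl; lra|].
    intros f _; unfold in_class; rewrite !shift_inv, mul_1l, mul_1r; auto.
  - intros f _; unfold out_class; rewrite !shift_inv, mul_1l, mul_1r; auto.
Qed.

Lemma eval_flow_terms_0 k ps x : ~ has_key k x -> eval (flow_terms k ps) x = 0.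
Proof.
  intros Hx; induction ps as [|q ps IH]; auto.
  unfold flow_terms; simpl; fold (flow_terms k ps).
  rewrite !eval_app, !eval_scale, IH; unfold spread.
  rewrite !(@eval_no_key k); auto; [lra|tauto|tauto].
Qed.

(** The mean of the functional at the identity alone, restricted to key [k]. By mass transport the
    mean over whole cells is this rate times the size of the cell. *)
Definition flow_rate (ps : list (R * (nat * (option V * option V)))) (k : nat) : R :=
  sumR (fun q => fst q *
    (mu (fun x => has_key k x /\ out_class A x (fst (snd q)) (fg_id r) = snd (snd q)) -
     mu (fun x => has_key k x /\ in_class A x (fst (snd q)) (fg_id r) = snd (snd q)))) ps.

Lemma integral_flow_terms k ps :
  integral mu (flow_terms k ps) = INR (snd (of_nat k)) * flow_rate ps k.
Proof.
  induction ps as [|q ps IH]; [unfold flow_terms, integral, flow_rate; simpl; lra|].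
  unfold flow_terms, flow_rate; simpl; fold (flow_terms k ps) (flow_rate ps k).
  rewrite !integral_app, !integral_scale, !mass_transport, IH
    by auto using borel_out, borel_in; lra.
Qed.

Lemma flow_rate_series ps :
  (forall q, In q ps -> (fst (snd q) < r)%nat) ->
  mu (fun x => ~ exists D, is_cell x D) = 0 -> is_series (flow_rate ps) 0.
Proof.
  intros Hps H0; induction ps as [|[a [i kappa]] ps IH].
  - apply is_series_Reals; intros eps Heps; exists 0%nat; intros n _.
    rewrite sum_eq_R0; [now rewrite Rdist_eq|auto].
  - assert (Hi : (i < r)%nat) by (apply (Hps (a, (i, kappa))); simpl; auto).
    replace 0 with (a * (mu (fun x => out_class A x i (fg_id r) = kappa) -
      mu (fun x => in_class A x i (fg_id r) = kappa)) + 0)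
      by (rewrite out_in_mu by auto; lra).
    apply (is_series_plus (fun k => a *
      (mu (fun x => has_key k x /\ out_class A x i (fg_id r) = kappa) -
       mu (fun x => has_key k x /\ in_class A x i (fg_id r) = kappa)))).
    + apply (@is_series_scal R_AbsRing R_NormedModule a),
        (@is_series_minus R_AbsRing R_NormedModule
        (fun k => mu (fun x => has_key k x /\ out_class A x i (fg_id r) = kappa)));
        apply key_series; auto using borel_out, borel_in.
    + apply IH; intros q Hq; apply Hps; simpl; auto.
Qed.

(** The rates are nonnegative by mass transport and sum to 0, hence each is 0. So the integral over
    cells with the key of [D0] vanishes, although it is at least [z * mu W]. *)
Lemma null_of_positive_flow ps W D0 z :
  (forall q, In q ps -> (fst (snd q) < r)%nat) ->
  mu (fun x => ~ exists D, is_cell x D) = 0 ->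
  forall Q, borel Q -> mu Q = 0 ->
  (forall x D, ~ Q x -> is_cell x D -> 0 <= lin ps (fun c => sumZ (flow A x c) D)) ->
  borel W ->
  (forall x, W x -> is_cell x D0 /\ lin ps (fun c => sumZ (flow A x c) D0) = z) ->
  z > 0 -> mu W = 0.
Proof.
  intros Hps H0 Q HQ HQ0 Hpos HW HWz Hz.
  assert (Hser := flow_rate_series _ Hps H0); apply is_series_Reals in Hser.
  assert (Hev : forall k x, ~ Q x -> 0 <= eval (flow_terms k ps) x).
  { intros k x Hx; destruct (classic (has_key k x)) as [(D & HD & <-)|Hk].
    - rewrite eval_flow_terms by auto; auto.
    - rewrite eval_flow_terms_0 by auto; lra. }
  assert (Hge : forall k, 0 <= flow_rate ps k).
  { intros k.
    assert (Hi : 0 <= integral mu (flow_terms k ps)).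
    { apply (integral_ge0 HV Hmu) with Q; auto; apply borel_flow_terms. }
    rewrite integral_flow_terms in Hi.
    (* A key of size 0 occurs for no cell, since cells contain the identity; its rate is 0 outright.
       Otherwise the positive size can be divided out. *)
    destruct (snd (of_nat k)) eqn:Ek.
    - apply Req_le; symmetry; unfold flow_rate.
      rewrite (sumR_ext_in _ (fun _ => 0)); [clear; induction ps; simpl; lra|].
      intros q _; rewrite !(mu_empty HV Hmu); [lra| |];
        intros x [(D & HD & <-) _]; unfold key in Ek; rewrite cancel_of_to in Ek;
        apply is_cell_id in HD; destruct D; solve [destruct HD | discriminate].
    - rewrite S_INR in Hi; pose proof (pos_INR n); nra. }
  assert (Hz0 : flow_rate ps (key D0) = 0).
  { apply Rle_antisym; auto.
    apply Rle_trans with (sum_f_R0 (flow_rate ps) (key D0)).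
    - destruct (key D0); simpl; [lra|].
      enough (0 <= sum_f_R0 (flow_rate ps) n) by lra.
      apply cond_pos_sum; auto.
    - apply sum_incr; auto. }
  assert (Hle : z * mu W <= integral mu (flow_terms (key D0) ps)).
  { replace (z * mu W) with (integral mu [(z, W)]) by (unfold integral; simpl; lra).
    apply (integral_le HV Hmu) with Q; auto.
    - intros t [<-|[]]; auto.
    - apply borel_flow_terms.
    - intros x Hx; unfold eval at 1; simpl.
      destruct (classic (W x)) as [Hw|Hw].
      + rewrite indZ_true by auto; destruct (HWz x Hw) as [HD <-].
        rewrite eval_flow_terms by auto; lra.
      + rewrite indZ_false by auto; specialize (Hev (key D0) x Hx); lra. }
  rewrite integral_flow_terms, Hz0 in Hle.
  pose proof (mu_ge0 Hmu HW); nra.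
Qed.
End Key.
End Cells.

(** * Essential cells and periodic configurations *)

Section Main.
Context {r : nat} {V : Type} (E : V -> V -> letter -> Prop) (A : list V).
Context (mu : (config r V -> Prop) -> R).
Hypothesis HC : countable V.
Hypothesis HV : inhabited V.
Hypothesis Hmu : prob_measure mu.
Hypothesis HX : mu (in_X E) = 1.
Hypothesis Hinv : shift_invariant mu.

Definition profile (x : config r V) (D : list (FG r)) : list Z :=
  map (fun c => sumZ (flow A x c) D) (coords (r := r) A).

Definition profile_event (t : list (FG r) * list Z) (x : config r V) : Prop :=
  is_cell A x (fst t) /\ profile x (fst t) = snd t.

(** The index set for [integer_relation]. A cell is judged by its shape and flow vector only, which
    leaves countably many events, so the null ones can be discarded together. *)
Definition essential (p : config r V * list (FG r)) : Prop :=
  in_X E (fst p) /\ is_cell A (fst p) (snd p) /\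
  mu (profile_event (snd p, profile (fst p) (snd p))) <> 0.

Lemma borel_profile_event t : borel (profile_event t).
Proof.
  apply (borel_and HV); [now apply borel_is_cell|].
  destruct t as [D z]; simpl; unfold profile; revert z.
  induction (coords A) as [|c cs IH]; intros [|n z]; simpl.
  - now apply borel_const.
  - eapply borel_ext, (borel_const HV False); intros x; split; [tauto|discriminate].
  - eapply borel_ext, (borel_const HV False); intros x; split; [tauto|discriminate].
  - apply borel_ext with (fun x => sumZ (flow A x c) D = n /\
      map (fun c => sumZ (flow A x c) D) cs = z).
    + intros x; split; [intros [-> ->]; auto|intros H; injection H; auto].
    + apply (borel_and HV); auto; revert n.
      apply (borelZ_sum HV (fun f x => flow A x c f)); intros f.
      unfold flow, Z.sub.
      apply (borelZ_plus HV); [|apply borelZ_opp]; apply (borelZ_ind HV);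
        [now apply borel_out|now apply borel_in].
Qed.

(** A relation among the flow vectors of essential cells that involves [p] is a balanced multiset of
    patches, which [glue_patches] turns into a periodic configuration. *)
Lemma essential_periodic p : essential p ->
  (exists Q, borel Q /\ mu Q = 0 /\ forall x, ~ Q x ->
     (exists D, is_cell A x D) /\ forall D, is_cell A x D -> essential (x, D)) ->
  exists x : config r V, in_X E x /\ periodic x /\ x (fg_id r) = fst p (fg_id r).
Proof.
  intros Hp (Q & HQ & HQ0 & HQe).
  destruct (@integer_relation _ (coords (r := r) A) {p | essential p}
    (fun j c => sumZ (flow A (fst (proj1_sig j)) c) (snd (proj1_sig j))))
    with (j0 := exist _ p Hp) as (l & Hl0 & Hl).
  (* A functional nonnegative on all essential cells and nonzero on this one would be positive here,
     and [null_of_positive_flow] would make the profile event of this cell null. *)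
  - intros ps Hps Hpos [[x0 D0] H0]; simpl.
    apply NNPP; intros Hne.
    assert (H0' := H0); destruct H0' as (H1 & H2 & H3); apply H3; simpl in *.
    destruct (countable_FG r) as [enc Henc].
    assert (Hcell : borel (fun x : config r V => ~ exists D, is_cell A x D)).
    { apply borel_compl, (borel_ex HV); [apply countable_list, countable_FG|].
      intros D; now apply borel_is_cell. }
    apply (null_of_positive_flow (A := A) enc Henc HC HV Hmu Hinv) with
      (ps := ps) (D0 := D0) (Q := Q) (z := lin ps (fun c => sumZ (flow A x0 c) D0)); auto.
    + intros q Hq; apply Hps in Hq; unfold coords in Hq.
      destruct q as [a [i k]]; apply in_prod_iff in Hq as [Hq _].
      apply in_seq in Hq; simpl; lia.
    + apply (mu_null_sub HV Hmu Hcell HQ); auto.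
      intros x Hx; apply NNPP; intros Hq; apply Hx, HQe, Hq.
    + intros x D Hx HD; apply HQe in Hx as [_ Hx].
      exact (Hpos (exist _ (x, D) (Hx D HD))).
    + apply borel_profile_event.
    + intros x [Hx Hprof]; split; auto; simpl in *.
      apply sumR_ext_in; intros q Hq; do 2 f_equal; apply Hps in Hq.
      exact (proj1 map_ext_in_iff Hprof _ Hq).
    + specialize (Hpos (exist _ (x0, D0) H0)); simpl in Hpos.
      apply Rlt_gt, Rnot_le_lt; intros Hle; apply Hne; lra.
  - apply (@glue_patches _ _ E A (map (@proj1_sig _ _) l) (fst p) (snd p)).
    + intros x D H; apply in_map_iff in H as ([[x' D'] (H1 & H2 & H3)] & H & _).
      simpl in *; injection H as -> ->; split; [|split]; auto; [apply H2|].
      now apply is_cell_hole_closed.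
    + apply in_map_iff; exists (exist _ p Hp); split; auto; now destruct p.
    + exact (is_cell_id (proj1 (proj2 Hp))).
    + intros c Hc; rewrite sumZ_map; now apply Hl.
Qed.

(** The exceptional set consists of the complement of the subshift, the null set where holes may be
    infinite, and the countably many null profile events. *)
Lemma essential_full : ae_on mu (in_X E) (fun x =>
    forall C, S_component (fun f => ~ In (x f) A) C -> finite_set C) ->
  exists Q, borel Q /\ mu Q = 0 /\ forall x, ~ Q x ->
     (exists D, is_cell A x D) /\ forall D, is_cell A x D -> essential (x, D).
Proof.
  intros (N & HN & HN0 & Hfin).
  assert (HXb : borel (fun x : config r V => ~ in_X E x))
    by now apply borel_compl, borel_in_X.
  assert (HX0 : mu (fun x => ~ in_X E x) = 0)
    by (rewrite (mu_compl HV Hmu), HX; [lra|now apply borel_in_X]).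
  set (T := fun t x => mu (profile_event t) = 0 /\ profile_event t x).
  assert (Hc : countable (list (FG r) * list Z)).
  { apply countable_prod; apply countable_list; [apply countable_FG|apply countable_Z]. }
  assert (HT : forall t, borel (T t)).
  { intros t; apply (borel_and HV); [now apply borel_const|apply borel_profile_event]. }
  assert (HT0 : mu (fun x => exists t, T t x) = 0).
  { apply (mu_null_ex HV Hmu); auto; intros t.
    destruct (classic (mu (profile_event t) = 0)) as [H|H].
    - apply (mu_null_sub HV Hmu (HT t) (borel_profile_event t)); auto; now intros x [].
    - apply (mu_empty HV Hmu); now intros x []. }
  assert (HTb : borel (fun x => exists t, T t x)) by now apply (borel_ex HV).
  exists (fun x => (~ in_X E x \/ N x) \/ exists t, T t x); split; [|split].
  - apply (borel_or HV); auto; now apply (borel_or HV).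
  - apply (mu_or_null HV Hmu); auto; [now apply (borel_or HV)|].
    now apply (mu_or_null HV Hmu).
  - intros x Hx.
    assert (Hxx : in_X E x) by (apply NNPP; tauto); split.
    + apply is_cell_exists; apply Hfin; auto.
    + intros D HD; repeat split; auto; try apply HD; simpl; intros H.
      apply Hx; right; eexists; split; [exact H|split; auto].
Qed.
End Main.

Theorem theorem6 (r : nat) (V : Type) (E : V -> V -> letter -> Prop)
  (HV : countable V) (A : list V) (mu : (config r V -> Prop) -> R)
  (Hmu : prob_measure mu) (HX : mu (in_X E) = 1)
  (Hinv : shift_invariant mu)
  (Hae : ae_on mu (in_X E) (fun x =>
     forall C, S_component (fun f => ~ In (x f) A) C -> finite_set C)) :
  (exists x : config r V, in_X E x /\ periodic x) /\
  (forall a1 : V, In a1 A ->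
     mu (fun x => in_X E x /\ x (fg_id r) = a1) > 0 ->
     exists x : config r V, in_X E x /\ periodic x /\ x (fg_id r) = a1).
Proof.
  assert (Hv : inhabited V) by (destruct Hae as (N & HN & _); exact (borel_inhabited HN)).
  assert (Hfull := essential_full A HV Hv Hmu HX Hae).
  (* An event of positive measure meets the complement of the exceptional set, and gluing through
     the root cell of such an [x] keeps its label at the identity. Both claims are instances: the
     whole subshift, and its part with label [a1]. *)
  assert (Hmeet : forall P, borel P -> mu P > 0 -> exists x, P x /\
    exists y : config r V, in_X E y /\ periodic y /\ y (fg_id r) = x (fg_id r)).
  { intros P HP HP0; destruct Hfull as (Q & HQ & HQ0 & HQe).
    destruct (mu_meets Hv Hmu HP HQ HP0 HQ0) as (x & Hx & Hq).
    exists x; split; auto; destruct (HQe x Hq) as [[D HD] Hess].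
    apply (essential_periodic HV Hv Hmu Hinv (Hess D HD)); now exists Q. }
  assert (HXb : borel (in_X (r := r) E)) by now apply borel_in_X.
  split.
  - destruct (Hmeet (in_X E) HXb) as (_ & _ & y & H1 & H2 & _); [lra|eauto].
  - intros a1 _ Ha1.
    destruct (Hmeet _ (borel_and Hv HXb (borel_cyl (fg_id r) a1)) Ha1)
      as (x & [_ <-] & Hy); auto.
Qed.
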